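(* Let $d\ge1$. For $R,M\ge2$, let $\mathcal D(R,M)$ be the event that for every point configuration $\omega$ on $\mathbb R^d\setminus\Lambda_{2R}$ and every pair of vertices $x,y\in\Lambda_R$, there exists a path of length at most $M$ in $G(\overline\eta_{|\Lambda_{2R}}\cup\omega)\cap\Lambda_{2R}$ between $x$ and $y$. Then there exist constants $C_0,c_0\in(0,\infty)$ such that for all $R\ge1$ and all $M$ with $C_0R\le M\le c_0R^d$, $$\mathbb P[\mathcal D(R,M)]\ge 1-e^{-c_0M}.$$
   Context: $\overline\eta$ is a Poisson point process of intensity $1$ on $\mathbb R^d$, and $\overline\eta_{|\Lambda_{2R}}=\overline\eta\cap\Lambda_{2R}$, where $\Lambda_r=[-r,r]^d$. A point configuration is a discrete (locally finite) subset. For a configuration $\xi$ of points in $\mathbb R^d$, its Voronoi cells are $C(x)=\{y\in\mathbb R^d:d(y,x)\le d(y,\xi)\}$, $x\in\xi$ (Euclidean distance), and $G(\xi)$ is the graph with vertex set $\xi$ and an edge between two points $x,y\in\xi$ when $C(x)$ and $C(y)$ share a side (a $(d-1)$-dimensional face). $G(\xi)\cap\Lambda_{2R}$ is the subgraph induced by the vertices lying in $\Lambda_{2R}$. The vertices in $\Lambda_R$ are thus the points of $\overline\eta\cap\Lambda_R$. *)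

(* Defs.v *)
From HB Require Import structures.
From mathcomp Require Import all_boot all_order all_algebra.
From mathcomp Require Import all_classical all_reals all_analysis.

Set Implicit Arguments.
Unset Strict Implicit.
Unset Printing Implicit Defensive.

Import Order.TTheory GRing.Theory Num.Theory.
Import numFieldNormedType.Exports.

Local Open Scope classical_set_scope.
Local Open Scope ring_scope.

(* The library norm on 'rV[R]_d is the sup norm, hence this definition. *)
Definition eucl_dist (R : realType) (d : nat) (x y : 'rV[R]_d) : R :=
  Num.sqrt (\sum_(i < d) (x 0 i - y 0 i) ^+ 2).

Definition dist_to_set (R : realType) (d : nat) (y : 'rV[R]_d)
    (xi : set 'rV[R]_d) : R :=
  inf [set eucl_dist y z | z in xi].

Definition cube (R : realType) (d : nat) (r : R) : set 'rV[R]_d :=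
  [set x | forall i : 'I_d, - r <= x 0 i <= r].

Definition configuration (R : realType) (d : nat) (xi : set 'rV[R]_d) : Prop :=
  forall r : R, finite_set (xi `&` cube r).

Definition voronoi_cell (R : realType) (d : nat) (xi : set 'rV[R]_d)
    (x : 'rV[R]_d) : set 'rV[R]_d :=
  [set y | eucl_dist y x <= dist_to_set y xi].

Definition aff_independent (R : realType) (d k : nat)
    (v : 'I_k.+1 -> 'rV[R]_d) : Prop :=
  row_free (\matrix_(i < k) (v (lift ord0 i) - v ord0)).

(* The affine hull of F has dimension k: F contains k + 1 affinely independent
   points but not k + 2 (the empty set has no dimension). *)
Definition affine_dim (R : realType) (d : nat) (F : set 'rV[R]_d) (k : nat)
    : Prop :=
  (exists v : 'I_k.+1 -> 'rV[R]_d, (forall i, F (v i)) /\ aff_independent v) /\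
  ~ (exists v : 'I_k.+2 -> 'rV[R]_d, (forall i, F (v i)) /\ aff_independent v).

Definition face (R : realType) (d : nat) (C F : set 'rV[R]_d) : Prop :=
  [/\ F `<=` C,
      forall (x y : 'rV[R]_d) (t : R),
        F x -> F y -> 0 <= t <= 1 -> F (t *: x + (1 - t) *: y) &
      forall (x y : 'rV[R]_d) (t : R),
        C x -> C y -> 0 < t < 1 -> F (t *: x + (1 - t) *: y) -> F x /\ F y].

Definition share_side (R : realType) (d : nat) (C1 C2 : set 'rV[R]_d) : Prop :=
  exists F : set 'rV[R]_d, [/\ face C1 F, face C2 F & affine_dim F d.-1].

Record graph (V : Type) := Graph {
  vertices : set V ;
  edge : V -> V -> Prop }.

Definition voronoi_graph (R : realType) (d : nat) (xi : set 'rV[R]_d)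
    : graph 'rV[R]_d :=
  Graph xi (fun x y =>
    [/\ xi x, xi y, x <> y &
        share_side (voronoi_cell xi x) (voronoi_cell xi y)]).

Definition induced_subgraph (V : Type) (G : graph V) (A : set V) : graph V :=
  Graph (vertices G `&` A) (fun x y => [/\ edge G x y, A x & A y]).

(* p lists the vertices of the path after x, so its length (number of edges)
   is size p. *)
Definition graph_path (V : eqType) (G : graph V) (x y : V) (p : seq V) : Prop :=
  [/\ forall z, z \in x :: p -> vertices G z,
      path (fun u v => `[< edge G u v >]) x p,
      uniq (x :: p) &
      last x p = y].

Definition event_D (R : realType) (d : nat) (Omega : Type)
    (eta : Omega -> set 'rV[R]_d) (r M : R) : set Omega :=
  [set w | forall omega : set 'rV[R]_d,
    configuration omega -> omega `<=` ~` cube (2 * r) ->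
    forall x y : 'rV[R]_d,
      (eta w `&` cube r) x -> (eta w `&` cube r) y ->
      exists p : seq 'rV[R]_d,
        graph_path
          (induced_subgraph
             (voronoi_graph ((eta w `&` cube (2 * r)) `|` omega))
             (cube (2 * r)))
          x y p /\ (size p)%:R <= M].

Definition borel_set (R : realType) (d : nat) (B : set 'rV[R]_d) : Prop :=
  <<s [set U : set 'rV[R]_d | open U] >> B.

(* Lebesgue measure of a Borel subset of R^d = R * R^(d-1), as the iterated
   integral of its sections (as in product_measure1, the underlying set
   function of the library's binary product measure). *)
Fixpoint volume (R : realType) (d : nat) : set 'rV[R]_d -> \bar R :=
  match d return set 'rV[R]_d -> \bar R with
  | 0%N => fun B => (\1_B 0)%:E
  | d'.+1 => fun B =>
      (\int[@lebesgue_measure R]_x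
         volume [set y : 'rV[R]_d' |
                  B (row_mx (const_mx x : 'rV[R]_1) y : 'rV[R]_d'.+1)])%E
  end.

(* The event that the random set eta has exactly k points in B. *)
Definition count_event (R : realType) (d : nat) (Omega : Type)
    (eta : Omega -> set 'rV[R]_d) (B : set 'rV[R]_d) (k : nat) : set Omega :=
  [set w | (eta w `&` B #= `I_k)%card].

(* The probability mass function is written out because the library's
   poisson_pmf takes the value 1 when its rate is 0; here the rate is 0 on
   null sets, where the formula (with 0 ^+ 0 = 1) gives the Dirac mass at 0. *)
Record poisson_process (R : realType) (d : nat) (disp : measure_display)
    (Omega : measurableType disp) (P : probability Omega R)
    (eta : Omega -> set 'rV[R]_d) : Prop := PoissonProcess {
  poisson_configuration : forall w, configuration (eta w) ;
  poisson_measurable : forall (B : set 'rV[R]_d) (k : nat),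
    borel_set B -> measurable (count_event eta B k) ;
  poisson_law : forall (B : set 'rV[R]_d) (k : nat),
    borel_set B -> (volume B < +oo)%E ->
    P (count_event eta B k) =
      (let v := fine (volume B) in expR (- v) * v ^+ k / k`!%:R)%:E ;
  poisson_independent : forall (n : nat) (B : 'I_n -> set 'rV[R]_d)
      (k : 'I_n -> nat),
    (forall i, borel_set (B i)) -> trivIset setT B ->
    P [set w | forall i, count_event eta (B i) (k i) w] =
      (\prod_(i < n) P (count_event eta (B i) (k i)))%E }.

(* P[D] >= p, for an event D given without a proof of measurability: D contains
   a measurable event of probability at least p. When D is measurable (or
   measurable for the completion of P) this is the usual meaning; a measure of
   the library is only meaningful on measurable sets. *)
Definition prob_ge (R : realType) (disp : measure_display)
    (Omega : measurableType disp) (P : probability Omega R)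
    (D : set Omega) (p : R) : Prop :=
  exists A : set Omega, [/\ measurable A, A `<=` D & (p%:E <= P A)%E].

(* Main.v *)
(** Cut the cube [[-2r, 2r]]^d into boxes of a large constant side. Perturb [y]
    to a point [q] of its cell such that the segment from [x] to [q] avoids all
    intersections of two cells of dimension less than [d - 1]; by connectedness of
    the segment, the cells that meet it contain a path of the Voronoi graph from
    [x] to [y]. A nucleus whose cell meets the segment near a box [Q] lies within
    a constant multiple of the distance from [Q] to the nearest occupied box.
    Hence these nuclei lie in a connected union of balls of boxes around the
    segment, whatever the outside configuration. By a Vitali covering argument,
    if this union has more than a constant times [r] boxes, a fixed proportion of
    its boxes is empty. A Peierls argument over walks of boxes, using only void
    probabilities and the Poisson tail, shows that with probability at least
    [1 - exp (- c0 M)] no connected set of at least [m ~ M / K] boxes has so many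
    empty boxes, and that no connected set of fewer than [m] boxes contains
    [K m <= M] points. *)

Require Import Defs.
From HB Require Import structures.
From mathcomp Require Import all_boot all_order all_algebra.
From mathcomp Require Import all_classical all_reals all_analysis.
From mathcomp Require Import measurable_realfun zify ring lra.

Import Order.TTheory GRing.Theory Num.Theory.
Import numFieldNormedType.Exports.

Set Implicit Arguments.
Unset Strict Implicit.
Unset Printing Implicit Defensive.

(** * Chains of boxes in a finite grid *)

Lemma leq_expl (a b k : nat) : a <= b -> a ^ k <= b ^ k.
Proof. by move=> ab; case: k => // k; rewrite leq_exp2r. Qed.

Section Walks.
Variables (T : finType) (e : rel T).

Lemma path_leaves (U V : {set T}) (x : T) (q : seq T) :
  path [rel a b | [&& e a b, a \in U & b \in U]] x q -> x \in V -> last x q \notin V ->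
  exists a b, [/\ e a b, a \in V, b \in U & b \notin V].
Proof.
elim: q x => [|y q IH] x /=; first by move=> _ ->.
case/andP=> /and3P[exy xU yU] pq xV lq.
have [yV|yV] := boolP (y \in V); first exact: IH pq yV lq.
by exists x, y.
Qed.

(** Induction on [k]: connectedness gives an edge from a visited [a] to an unvisited [b] of [U], and
    the detour [a, b, a] costs two steps for one new vertex. Connected sets can thus be counted
    through walks of known length. *)
Lemma covering_walk (U : {set T}) (x : T) (k : nat) :
  symmetric e -> x \in U ->
  (forall v, v \in U -> connect [rel a b | [&& e a b, a \in U & b \in U]] x v) ->
  k < #|U| ->
  exists p, [/\ path e x p, size p = k.*2, [set y in x :: p] \subset U &
               #|[set y in x :: p]| = k.+1].
Proof.
move=> esym xU conn; elim: k => [|k IH] kU.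
  exists [::]; split => //; first by apply/fintype.subsetP => y; rewrite !inE => /eqP->.
  by rewrite set_seq1 cards1.
have {IH}[p [pp sp pU cp]] := IH (ltnW kU).
set V := [set y in x :: p] in pU cp.
have /fintype.subsetPn[v vU vV] : ~~ (U \subset V).
  by apply/negP => /subset_leq_card; rewrite cp leqNgt kU.
have /connectP[q pq lq] := conn v vU.
have xV : x \in V by rewrite !inE eqxx.
have [|a [b [eab aV bU bV]]] := path_leaves pq xV; first by rewrite -lq.
move: aV; rewrite inE => /splitPl ap.
case: ap pp sp @V pU cp vV xV bV => p1 p2 lp1 pp sp V pU cp vV xV bV.
have W : [set y in x :: p1 ++ b :: a :: p2] = b |: V.
    have ap : a \in x :: p1 by rewrite -lp1 mem_last.
  apply/finset.setP => y; rewrite !inE !mem_cat !inE.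
  have [->|] := eqVneq y a; last by case: (y == x); case: (y == b); rewrite ?orbT.
  by move: ap; rewrite inE => /orP[]->; rewrite ?orbT.
exists (p1 ++ b :: a :: p2); split.
- move: pp; rewrite !cat_path /= lp1 => /andP[-> ->].
  by rewrite eab esym eab.
- by move: sp; rewrite !size_cat /= doubleS => <-; rewrite !addnS.
- by rewrite W finset.subUset finset.sub1set bU.
- by rewrite W cardsU1 bV cp.
Qed.

End Walks.

(** * Sup-norm balls in the grid and coverings by them *)

Section Grid.
Variables (d n : nat).
Local Notation T := {ffun 'I_d -> 'I_n}.

Definition near (k : nat) : rel T :=
  fun u v : T => [forall i, (u i <= v i + k) && (v i <= u i + k)].

Definition gball (u : T) (k : nat) : {set T} := [set v | near k u v].

Lemma nearP k (u v : T) :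
  reflect (forall i, u i <= v i + k /\ v i <= u i + k) (near k u v).
Proof. by apply: (iffP forallP) => H i; have /andP := H i. Qed.

Lemma near_sym k : symmetric (near k).
Proof. by move=> u v; apply/eq_forallb => i; rewrite andbC. Qed.

Lemma near_refl k (u : T) : near k u u.
Proof. by apply/nearP => i; rewrite leq_addr. Qed.

Lemma near_trans k l (u v w : T) : near k u v -> near l v w -> near (k + l) u w.
Proof. by move=> /nearP H1 /nearP H2; apply/nearP => i; have := H1 i; have := H2 i; lia. Qed.

Lemma nearW k l (u v : T) : k <= l -> near k u v -> near l u v.
Proof. by move=> kl /nearP H; apply/nearP => i; have := H i; lia. Qed.

Lemma card_interval_le (a : 'I_n) k :
  #|[pred j : 'I_n | (a <= j + k) && (j <= a + k)]| <= k.*2.+1.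
Proof.
rewrite cardE -(size_map val) -(size_iota (a - k) k.*2.+1).
apply: uniq_leq_size; first by rewrite (map_inj_uniq val_inj) enum_uniq.
move=> _ /mapP[j + ->]; rewrite mem_enum inE mem_iota /=; lia.
Qed.

Lemma card_interval_ge (a : 'I_n) k : k < n ->
  k < #|[pred j : 'I_n | (a <= j + k) && (j <= a + k)]|.
Proof.
(* Near the upper end of the grid the [k.+1] indices are shifted down to fit below [n]; they stay
   within [k] of [a]. *)
move=> kn; rewrite cardE -(size_map val) -{1}(size_iota (minn a (n - k.+1)) k.+1).
apply: uniq_leq_size; first exact: iota_uniq.
move=> j; rewrite mem_iota => jH.
have jn : j < n by have := ltn_ord a; lia.
apply/mapP; exists (Ordinal jn) => //; rewrite mem_enum inE /=.
by have := ltn_ord a; lia.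
Qed.

Lemma card_gball (u : T) k :
  #|gball u k| = \prod_(i < d) #|[pred j : 'I_n | (u i <= j + k) && (j <= u i + k)]|.
Proof.
pose F := fun i : 'I_d => [pred j : 'I_n | (u i <= j + k) && (j <= u i + k)].
transitivity #|family F|; last by rewrite card_family foldrE big_map big_enum.
apply: eq_card => v; rewrite inE.
by apply/nearP/familyP => H i; have := H i; rewrite inE => /andP.
Qed.

Lemma card_gball_le (u : T) k : #|gball u k| <= k.*2.+1 ^ d.
Proof.
rewrite card_gball -[X in _ ^ X]card_ord -prod_nat_const.
by apply: leq_prod => i _; exact: card_interval_le.
Qed.

Lemma card_gball_ge (u : T) k : k < n -> k.+1 ^ d <= #|gball u k|.
Proof.
move=> kn; rewrite card_gball -[X in _ ^ X]card_ord -prod_nat_const.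
by apply: leq_prod => i _; exact: card_interval_ge.
Qed.


Lemma gball_refl (u : T) k : u \in gball u k.
Proof. by rewrite inE near_refl. Qed.

Lemma gball_connected (u v : T) k (U : {set T}) : gball u k \subset U -> v \in gball u k ->
  connect [rel a b | [&& near 1 a b, a \in U & b \in U]] u v.
Proof.
elim: k v => [|k IH] v sU.
  rewrite inE => /nearP uv; suff -> : v = u by [].
  by apply/ffunP => i; apply/val_inj => /=; have := uv i; lia.
rewrite inE => uv.
have kk : gball u k \subset gball u k.+1.
  by apply/fintype.subsetP => z; rewrite !inE; apply: nearW.
(* Clamping [v] coordinatewise to the ball of radius [k] around [u] gives a point of that ball
   within distance 1 of [v]. *)
have step i : minn (maxn (v i) (u i - k)) (u i + k) < n.
  by have := ltn_ord (v i); have := ltn_ord (u i); have /nearP/(_ i) := uv; lia.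
pose w : T := [ffun i => Ordinal (step i)].
have uw : w \in gball u k.
  by rewrite inE; apply/nearP => i; rewrite ffunE /=; have /nearP/(_ i) := uv; lia.
apply: connect_trans (IH _ (fintype.subset_trans kk sU) uw) (connect1 _).
rewrite /= (fintype.subsetP sU) ?(fintype.subsetP sU) ?inE //=.
  by rewrite andbT; apply/nearP => i; rewrite ffunE /=; have /nearP/(_ i) := uv; lia.
by apply: nearW (leqnSn k) _; rewrite inE in uw.
Qed.

(* Discrete Vitali covering: the largest small ball absorbs, in its dilation,
   the dilations of all the small balls that it meets. *)
Lemma vitali (D : nat) (s : seq (T * nat)) (E : {set T}) : 0 < D ->
  (forall q : T * nat, q \in s -> q.2 < n /\ gball q.1 q.2 \subset E) ->
  #|[set v | has (fun q => v \in gball q.1 (D * (q.2 + 5))) s]|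
    <= (10 * D + 2) ^ d * #|E|.
Proof.
move=> D0; have [k] := ubnP (size s); elim: k s E => // k IH s E.
case: s => [|q0 s0].
  by move=> _ _; rewrite [X in #|pred_of_set X|](_ : _ = finset.set0) ?cards0 //; apply/finset.setP => v; rewrite !inE.
set s := q0 :: s0 => sk sE.
pose M := \max_(q <- s) q.2.
have [q qs qM] : exists2 q : T * nat, q \in s & q.2 = M.
  have : exists2 q : T * nat, q \in s & q.2 = \max_(q <- s) q.2; last by [].
  rewrite /s; elim: (s0) (q0) => [|q2 s2 IHs] q1.
    by exists q1; rewrite ?mem_head // big_seq1.
  rewrite big_cons; have [q3 q3s <-] := IHs q2.
  have [le13|le31] := leqP q1.2 q3.2.
    by exists q3; rewrite ?(maxn_idPr le13) // inE q3s orbT.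
  by exists q1; rewrite ?mem_head // (maxn_idPl (ltnW le31)).
pose far := [pred r : T * nat | [disjoint gball r.1 r.2 & gball q.1 q.2]].
have sF : size (seq.filter far s) < k.
  have : count (predC far) s > 0.
    rewrite -has_count; apply/hasP; exists q => //=.
    by rewrite -finset.setI_eq0 finset.setIid; apply/finset.set0Pn; exists q.1; exact: gball_refl.
  rewrite size_filter; have := count_predC far s; lia.
have [qn qE] := sE _ qs.
(* Balls disjoint from the largest one lie in [E] minus it, so the inductive bound and [cq] add up
   to a multiple of [#|E|]. *)
have FE r : r \in seq.filter far s -> r.2 < n /\ gball r.1 r.2 \subset E :\: gball q.1 q.2.
  rewrite mem_filter => /andP[fr rs]; have [-> rE] := sE _ rs; split => //.
  by rewrite finset.subsetD rE.
have {IH} := IH _ _ sF FE.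
have cq : #|gball q.1 (2 * q.2 + D * (q.2 + 5))| <= (10 * D + 2) ^ d * #|gball q.1 q.2|.
  apply: leq_trans (card_gball_le _ _) _.
  apply: leq_trans (leq_mul (leqnn _) (card_gball_ge q.1 qn)).
  by rewrite -expnMn; apply: leq_expl; nia.
have := cardsID (gball q.1 q.2) E; rewrite (finset.setIidPr qE) => <-; rewrite mulnDr.
move=> IHF; apply: leq_trans (leq_add cq IHF).
apply: leq_trans (leq_card_setU _ _); apply: subset_leq_card.
apply/fintype.subsetP => v; rewrite !inE => /hasP[r rs vr].
have [fr|] := boolP (far r).
  by apply/orP; right; apply/hasP; exists r => //; rewrite mem_filter fr.
rewrite /= -setI_eq0 => /finset.set0Pn[z]; rewrite !inE => /andP[rz qz].
apply/orP; left.
have rM : r.2 <= q.2 by rewrite qM; apply: leq_bigmax_seq.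
rewrite inE in vr; rewrite near_sym in rz.
have := near_trans qz (near_trans rz vr); apply: nearW.
by rewrite mul2n -addnn -addnA leq_add2l leq_add // leq_mul2l leq_add2r rM orbT.
Qed.


(** Around each [Q j] take a vacant ball of maximal radius [t j], cut off at [K0], and let [U] be
    the union of these balls dilated by [D]. The Vitali bound controls [#|U|] by its vacant boxes
    plus a term linear in [J], so [sparse] forces [#|U| < m]; the walk is one that covers [U]. *)
Lemma chain_cover (occ : pred T) (Q : nat -> T) (J D K0 m : nat) :
  0 < D -> (forall j, j < J -> near 1 (Q j) (Q j.+1)) -> K0 < n ->
  2 * (10 * D + 2) ^ d * J.+1 <= m -> m <= K0.+1 ^ d ->
  (forall x p, path (near 1) x p -> let U := [set y in x :: p] in
     size p = #|U|.-1.*2 -> m <= #|U| ->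
     2 * (10 * D + 2) ^ d * #|[set v in U | ~~ occ v]| < #|U|) ->
  exists p, [/\ path (near 1) (Q 0) p, size p = m.*2 &
    forall j, j <= J -> exists t v, [/\ t < K0, occ v, v \in gball (Q j) t.+1 &
      forall w, w \in gball (Q j) (D * (t + 5)) -> w \in Q 0 :: p]].
Proof.
move=> D0 adjQ K0n mJ mK sparse.
pose empty j t := [forall v in gball (Q j) t, ~~ occ v].
(* Radius 0 carries no claim of vacancy, since [Q j] itself may be occupied. *)
have H j : exists t, [/\ t <= K0, t < K0 -> (exists2 v : T, occ v & v \in gball (Q j) t.+1) &
    0 < t -> empty j t].
  elim: K0 {K0n mK} => [|K [t [tK tO tE]]]; first by exists 0.
  have [tlt|] := ltnP t K; first by exists t; split; [exact: (leq_trans tK (leqnSn _)) | move=> _; exact: tO | exact: tE].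
  move=> Kt; have {Kt tK tO}tK : t = K by apply/eqP; rewrite eqn_leq tK.
  subst t; have [eK|] := boolP (empty j K.+1); first by exists K.+1; rewrite ltnn.
  rewrite negb_forall => /existsP[v]; rewrite negb_imply negbK => /andP[vB vo].
  by exists K; split => // _; exists v.
have {H}[t tP] := boolp.choice H.
pose U := [set v | has (fun j => v \in gball (Q j) (D * (t j + 5))) (iota 0 J.+1)].
have BU j : j <= J -> gball (Q j) (D * (t j + 5)) \subset U.
  move=> jJ; apply/fintype.subsetP => v vB; rewrite inE; apply/hasP; exists j => //.
  by rewrite mem_iota add0n ltnS jJ.
have QU j : j <= J -> Q j \in U.
  by move=> /BU/fintype.subsetP; apply; exact: gball_refl.
have conn v : v \in U -> connect [rel a b | [&& near 1 a b, a \in U & b \in U]] (Q 0) v.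
  rewrite inE => /hasP[j]; rewrite mem_iota add0n ltnS => /andP[_ jJ] vB.
  apply: connect_trans (gball_connected (BU _ jJ) vB).
  elim: j jJ {vB} => [|j IH] jJ; first exact: connect0.
  apply: connect_trans (IH (ltnW jJ)) (connect1 _).
  by rewrite /= adjQ // !QU // ltnW.
have U0 : 0 < #|U| by apply/card_gt0P; exists (Q 0); exact: QU.
have [|p [pp sp pU cp]] := covering_walk (near_sym 1) (QU 0 (leq0n _)) conn (k := #|U|.-1).
  by rewrite prednK.
have {cp}pU : [set y in Q 0 :: p] = U.
  by apply/eqP; rewrite eqEcard pU cp prednK /=.
have [mU|Um] := leqP m #|U|.
  have := sparse _ _ pp; rewrite /= pU => /(_ sp mU).
  set E := [set v in U | ~~ occ v] => EU.
  (* Indices of radius 0 have no vacant ball: their dilated balls are counted one by one, and only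
     [s1] goes through the covering lemma. *)
  pose s0 := [seq j <- iota 0 J.+1 | t j == 0].
  pose s1 := [seq (Q j, t j) | j <- [seq j <- iota 0 J.+1 | t j != 0]].
  have V1 : forall q, q \in s1 -> q.2 < n /\ gball q.1 q.2 \subset E.
    move=> _ /mapP[j + ->]; rewrite mem_filter mem_iota add0n ltnS /= => /andP[tj jJ].
    have [tK _ tE] := tP j; split; first exact: leq_ltn_trans K0n.
    apply/fintype.subsetP => v vB; rewrite inE.
    have /forall_inP-> // := tE (ltac:(by rewrite lt0n)).
    rewrite andbT; apply: (fintype.subsetP (BU _ jJ)); move: vB; rewrite !inE.
    by apply: nearW; nia.
  have V0 : #|[set v | has (fun j => v \in gball (Q j) (D * 5)) s0]| <= (10 * D + 2) ^ d * J.+1.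
    have : size s0 <= J.+1 by rewrite size_filter -[X in _ <= X](size_iota 0) count_size.
    move: J.+1; elim: s0 => [|j s IH] [|N] //= sN.
      by rewrite muln0 (_ : [set _ | _] = finset.set0) ?cards0 //; apply/finset.setP => v; rewrite !inE.
      by rewrite (_ : [set _ | _] = finset.set0) ?cards0 //; apply/finset.setP => v; rewrite !inE.
    have cj : #|gball (Q j) (D * 5)| <= (10 * D + 2) ^ d.
      by apply: leq_trans (card_gball_le _ _) _; apply: leq_expl; lia.
    rewrite [X in _ <= X]mulnS; apply: leq_trans (leq_add cj (IH _ sN)).
    apply: leq_trans (leq_card_setU _ _); apply: subset_leq_card.
    by apply/fintype.subsetP => v; rewrite !inE.
  have : #|U| <= (10 * D + 2) ^ d * J.+1 + (10 * D + 2) ^ d * #|E|.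
    apply: leq_trans (leq_add V0 (vitali D0 V1)).
    apply: leq_trans (leq_card_setU _ _); apply: subset_leq_card.
    apply/fintype.subsetP => v; rewrite !inE => /hasP[j jJ vB].
    have [tj|tj] := boolP (t j == 0).
      apply/orP; left; apply/hasP; exists j; first by rewrite mem_filter tj.
      by move: vB; rewrite (eqP tj).
    apply/orP; right; apply/hasP; exists (Q j, t j) => //.
    by apply: map_f; rewrite mem_filter tj.
  (* With [C = (10 * D + 2) ^ d], the bound [#|U| <= C * J.+1 + C * #|E|] contradicts
     [2 * C * J.+1 <= m <= #|U|] and [2 * C * #|E| < #|U|]. *)
  move=> UC; exfalso; move: UC EU mJ mU; rewrite -!mulnA.
  move: (_ * J.+1) (_ * #|E|) => a b h1 h2 h3 h4.
  have := leq_trans (leq_add (leq_trans h3 h4) h2) (leq_add h1 h1); lia.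
have lp : size p <= m.*2 by rewrite sp leq_double (leq_trans (leq_pred _) (ltnW Um)).
(* As [near 1] is reflexive, the walk waits at its last box up to length [m.*2], so that a single
   length enters the union bound. *)
exists (p ++ nseq (m.*2 - size p) (last (Q 0) p)); split.
- rewrite cat_path pp /=; elim: (_ - _) => //= k ->.
  by rewrite near_refl.
- by rewrite size_cat size_nseq subnKC.
- move=> j jJ; have [tK tO _] := tP j.
  have tlt : t j < K0.
    (* A radius equal to [K0] would put a ball of at least [K0.+1 ^ d >= m] boxes inside [U]. *)
    rewrite ltn_neqAle tK andbT; apply/eqP => tj.
    move: Um; rewrite ltnNge => /negP; apply; apply: leq_trans mK _.
    apply: leq_trans (card_gball_ge (Q j) K0n) _; apply: subset_leq_card.
    apply: fintype.subset_trans (BU _ jJ); apply/fintype.subsetP => v; rewrite !inE.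
    by apply: nearW; rewrite tj; nia.
  have [v vo vB] := tO tlt; exists (t j), v; split => // w wB.
  have : w \in U by apply: (fintype.subsetP (BU _ jJ)).
  by rewrite -pU !inE mem_cat => /orP[->|->]; rewrite ?orbT.
Qed.

End Grid.

Local Open Scope classical_set_scope.
Local Open Scope ring_scope.

(** * Voronoi paths along a segment *)

Section Voronoi.
Variables (R : realType) (d : nat).
Local Notation V := 'rV[R]_d.
Implicit Types (a b u v x y z : V) (xi : set V).

Definition dot u v : R := \sum_(i < d) u 0 i * v 0 i.

Lemma dotC u v : dot u v = dot v u.
Proof. by apply: eq_bigr => i _; rewrite mulrC. Qed.

Lemma dotDl u v z : dot (u + v) z = dot u z + dot v z.
Proof. by rewrite -big_split; apply: eq_bigr => i _; rewrite mxE mulrDl. Qed.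

Lemma dotZl c u z : dot (c *: u) z = c * dot u z.
Proof. by rewrite mulr_sumr; apply: eq_bigr => i _; rewrite mxE mulrA. Qed.

Lemma dotNl u z : dot (- u) z = - dot u z.
Proof. by rewrite -scaleN1r dotZl mulN1r. Qed.

Lemma dotDr u v z : dot z (u + v) = dot z u + dot z v.
Proof. by rewrite !(dotC z) dotDl. Qed.

Lemma dotZr c u z : dot z (c *: u) = c * dot z u.
Proof. by rewrite !(dotC z) dotZl. Qed.

Lemma dotNr u z : dot z (- u) = - dot z u.
Proof. by rewrite !(dotC z) dotNl. Qed.

Lemma dotE u v : (u *m v^T) 0 0 = dot u v.
Proof. by rewrite mxE; apply: eq_bigr => i _; rewrite mxE. Qed.

Lemma dot_ge0 u : 0 <= dot u u.
Proof. by apply: sumr_ge0 => i _; rewrite -expr2 sqr_ge0. Qed.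

Lemma dot_eq0 u : (dot u u == 0) = (u == 0).
Proof.
apply/idP/eqP => [|->]; last by rewrite -(scale0r 0) dotZl mul0r.
rewrite psumr_eq0 => [/allP u0|i _]; last by rewrite -expr2 sqr_ge0.
apply/rowP => i; rewrite mxE; have := u0 i (mem_index_enum i).
by rewrite /= mulf_eq0 orbb => /eqP.
Qed.

(* The power of z with respect to a, up to the term |z|^2: this is affine in z. *)
Definition pw z a : R := dot a a - 2 * dot z a.

Lemma dist_pw z a : eucl_dist z a = Num.sqrt (dot z z + pw z a).
Proof.
rewrite /eucl_dist; congr Num.sqrt.
have -> : dot z z + pw z a = dot (z - a) (z - a).
  by rewrite /pw !(dotDl, dotDr, dotNl, dotNr) (dotC a z); ring.
by apply: eq_bigr => i _; rewrite !mxE expr2.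
Qed.

Lemma pw_dist_ge0 z a : 0 <= dot z z + pw z a.
Proof.
have -> : dot z z + pw z a = dot (z - a) (z - a).
  by rewrite /pw !(dotDl, dotDr, dotNl, dotNr) (dotC a z); ring.
exact: dot_ge0.
Qed.

Lemma le_dist_pw z a b : (eucl_dist z a <= eucl_dist z b) = (pw z a <= pw z b).
Proof. by rewrite !dist_pw ler_psqrt ?nnegrE ?pw_dist_ge0 // lerD2l. Qed.

Lemma pw_convex (t : R) u v a : pw (t *: u + (1 - t) *: v) a = t * pw u a + (1 - t) * pw v a.
Proof. by rewrite /pw dotDl !dotZl; ring. Qed.

Lemma cellP xi a z : xi a ->
  voronoi_cell xi a z <-> forall b, xi b -> pw z a <= pw z b.
Proof.
move=> xa; rewrite /voronoi_cell /dist_to_set /=; split=> [H b xb|H].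
  rewrite -le_dist_pw; apply: le_trans H _.
  apply: ge_inf; last by exists b.
  by exists 0 => _ [c _ <-]; exact: sqrtr_ge0.
apply: lb_le_inf; first by exists (eucl_dist z a), a.
by move=> _ [b xb <-]; rewrite le_dist_pw; exact: H.
Qed.

(** On a segment of the cell of [a], the affine function [pw z b - pw z a] is nonnegative at both
    ends; if it is at most 0 at an interior point, it vanishes at both ends. *)
Lemma face_cell_inter xi a b : xi a -> xi b ->
  face (voronoi_cell xi a) (voronoi_cell xi a `&` voronoi_cell xi b).
Proof.
move=> xa xb; split.
- by move=> z [].
- move=> u v t [ua ub] [va vb] /andP[t0 t1].
  have conv c : xi c -> voronoi_cell xi c u -> voronoi_cell xi c v ->
      voronoi_cell xi c (t *: u + (1 - t) *: v).
    move=> xc /(cellP _ xc) uc /(cellP _ xc) vc; apply/(cellP _ xc) => e xe.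
    by rewrite !pw_convex lerD // ler_wpM2l ?subr_ge0 ?uc ?vc.
  by split; exact: conv.
- move=> u v t ua va /andP[t0 t1] [_ /(cellP _ xb)/(_ _ xa)].
  move/(cellP _ xa): (ua) => Hu; move/(cellP _ xa): (va) => Hv.
  rewrite !pw_convex => tb.
  have ub := Hu _ xb; have vb := Hv _ xb.
  have eu : pw u b = pw u a by nra.
  have ev : pw v b = pw v a by nra.
  by split; split => //; apply/(cellP _ xb) => c xc; rewrite (eu, ev); [exact: Hu | exact: Hv].
Qed.

End Voronoi.

(** * Dimension of the intersection of two cells *)

Section SharedSide.
Variables (R : realType) (d : nat).
Local Notation V := 'rV[R]_d.
Implicit Types (a b u v x y z : V) (xi F : set V).

(** Greedy choice: fewer than [d] differences leave a nonzero [n] orthogonal to all of them, and a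
    point [g] of [F] with [dot n (g - x) != 0] yields a difference independent of them. *)
Lemma spanning_points F x k :
  (forall n, n != 0 -> exists2 f, F f & dot n (f - x) != 0) -> (k <= d)%N ->
  exists f : 'I_k -> V, (forall i, F (f i)) /\ row_free (\matrix_(i < k) (f i - x)).
Proof.
move=> span; elim: k => [|k IH] kd.
  exists (fun=> 0); split; first by case.
  by rewrite /row_free flatmx0 mxrank0.
have [f [Ff Af]] := IH (ltnW kd).
set A := \matrix_(i < k) _ in Af.
have : kermx A^T != 0.
  rewrite kermx_eq0 -row_leq_rank -ltnNge mxrank_tr.
  by apply: leq_ltn_trans kd; exact: rank_leq_row.
case/rowV0Pn => n /sub_kermxP nA n0.
have [g Fg ng] := span n n0.
pose h (i : 'I_k.+1) := if unlift ord0 i is Some j then f j else g.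
exists h; split; first by move=> i; rewrite /h; case: unlift.
apply: inj_row_free => w /=.
pose w' : 'rV_k := \row_i w 0 (lift ord0 i).
have -> : w *m (\matrix_i (h i - x)) = w 0 ord0 *: (g - x) + w' *m A.
  apply/rowP => j; rewrite !mxE big_ord_recl !mxE /h unlift_none; congr (_ + _).
  by apply: eq_bigr => i _; rewrite !mxE liftK.
move=> wM; have w0 : w 0 ord0 = 0.
  have := congr1 (fun u => dot u n) wM.
  rewrite dotDl dotZl -[X in _ + X]dotE -mulmxA.
  have -> : A *m n^T = 0 by rewrite -[A]trmxK -trmx_mul nA trmx0.
  rewrite mulmx0 mxE addr0 (dotC 0) -(scale0r 0) dotZr mul0r => /eqP.
  by rewrite mulf_eq0 dotC (negPf ng) orbF => /eqP.
have w'0 : w' = 0.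
  move: wM; rewrite w0 scale0r add0r => wA.
  by apply/eqP; rewrite -(mulmx_free_eq0 _ Af) wA.
apply/rowP => i; rewrite mxE; have [j ->|->//] := unliftP ord0 i.
by have := congr1 (fun u : 'rV_k => u 0 j) w'0; rewrite !mxE.
Qed.

End SharedSide.

Section SharedSideS.
Variables (R : realType) (d : nat).
Local Notation V := 'rV[R]_d.+1.
Implicit Types (a b u v x y z : V) (xi F : set V).

(** Points of [F] whose differences with [x] are linearly independent are affinely independent,
    which gives dimension at least [d] in ambient dimension [d.+1]; it is at most [d] because [F]
    lies in the bisector of [a] and [b]. The second alternative describes the intersections that a
    generic segment from [x] avoids. *)
Lemma share_side_or_hyperplane xi a b x : xi a -> xi b -> a != b ->
  let F := voronoi_cell xi a `&` voronoi_cell xi b in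
  share_side (voronoi_cell xi a) (voronoi_cell xi b) \/
  exists2 n, n != 0 & forall f, F f -> dot n (f - x) = 0.
Proof.
move=> xa xb ab F.
have [?|span] := pselect (exists2 n, n != 0 & forall f, F f -> dot n (f - x) = 0).
  by right.
left; exists F; split.
- exact: face_cell_inter.
- by rewrite /F setIC; exact: face_cell_inter.
split.
- have [|f [Ff Af]] := @spanning_points R _ F x d.+1 _ (leqnn _).
    move=> n n0; apply: contra_notP span => span; exists n => // f Ff.
    by apply/eqP; apply: contra_notT span => nf; exists f.
  exists f; split => //; apply: inj_row_free => w wM.
  (* A combination of the differences with [f ord0] is one of the vectors [f i - x], where
     [f ord0 - x] gets minus the sum of the weights. *)
  pose w' : 'rV_d.+1 := \row_i (if unlift ord0 i is Some j then w 0 j else - \sum_j w 0 j).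
  have : w' = 0.
    apply/eqP; rewrite -(mulmx_free_eq0 _ Af); apply/eqP/rowP => j.
    have := congr1 (fun u : V => u 0 j) wM; rewrite [RHS]mxE mxE => wMj.
    rewrite [RHS]mxE -[RHS]wMj.
    rewrite mxE big_ord_recl !mxE unlift_none mulNr mulr_suml -sumrN -big_split.
    by apply: eq_bigr => i _; rewrite !mxE liftK /=; ring.
  move/rowP => w'0; apply/rowP => j.
  by have := w'0 (lift ord0 j); rewrite !mxE liftK.
- case=> f [Ff Af]; move/negP: ab; apply.
  rewrite -subr_eq0 -trmx_eq0.
  have Fpw i : pw (f i) a = pw (f i) b.
    by have [/(cellP _ xa) Ha /(cellP _ xb) Hb] := Ff i; apply/eqP; rewrite eq_le Ha ?Hb.
  (* A basis of differences, all orthogonal to [a - b], forces [a = b]. *)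
  have Mu : \matrix_(i < d.+1) (f (lift ord0 i) - f ord0) \in unitmx by rewrite -row_free_unit.
  rewrite -(mulKmx Mu (a - b)^T) (_ : _ *m (a - b)^T = 0) ?mulmx0 //.
  apply/colP => i; have e1 := Fpw (lift ord0 i); have e0 := Fpw ord0.
  have -> : ((\matrix_i (f (lift ord0 i) - f ord0)) *m (a - b)^T) i 0
     = dot (f (lift ord0 i) - f ord0) (a - b).
    by rewrite mxE; apply: eq_bigr => j _; rewrite !mxE.
  by rewrite mxE; move: e1 e0; rewrite /pw !(dotDl, dotDr, dotNl, dotNr); lra.
Qed.

End SharedSideS.

(** * Generic segments and connectedness *)

Section VoronoiPath.
Variables (R : realType) (d : nat).
Local Notation V := 'rV[R]_d.+1.
Implicit Types (a b u v x y z : V) (xi F : set V).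

Lemma poly_small_nonroot (p : {poly R}) (e : R) :
  p != 0 -> 0 < e -> exists t, 0 < t < e /\ p.[t] != 0.
Proof.
move=> p0 e0; apply: contrapT => H.
(* These are [size p] distinct points, too many to be roots of [p]; [k.+2] keeps them strictly below
   [e]. *)
pose rs := [seq e / k.+2%:R | k <- iota 0 (size p)].
have : (size rs < size p)%N.
  apply: max_poly_roots => //.
    apply/allP => _ /mapP[k _ ->]; apply: contra_notT H => H.
    exists (e / k.+2%:R); split => //.
    by rewrite divr_gt0 ?ltr0n //= ltr_pdivrMr ?ltr0n // ltr_pMr // ltr1n.
  rewrite map_inj_uniq ?iota_uniq // => i j /(mulfI (lt0r_neq0 e0))/invr_inj/eqP.
  by rewrite eqr_nat => /eqP[].
by rewrite size_map size_iota ltnn.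
Qed.

(* The curve t |-> y + (t, t^2, ..., t^d) meets each hyperplane finitely often. *)
Lemma generic_point (s : seq V) x y (e : R) : 0 < e -> (forall n, n \in s -> n != 0) ->
  exists q : V, (forall i, `|q 0 i - y 0 i| < e) /\ forall n, n \in s -> dot n (q - x) != 0.
Proof.
move=> e0 s0.
(* The coefficient of degree [i.+1] of [P n] is the entry [i] of [n], so [P n] is nonzero; a
   non-root of the product over [s] serves all hyperplanes at once. *)
pose P n : {poly R} := (dot n (y - x))%:P + \sum_(i < d.+1) n 0 i *: 'X^(i.+1).
have P0 n : n \in s -> P n != 0.
  move=> /s0; apply: contra => /eqP Pn; apply/eqP/rowP => i; rewrite mxE.
  have := congr1 (fun p : {poly R} => p`_i.+1) Pn; rewrite coefD coefC /= add0r coef0 coef_sum.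
  rewrite (bigD1 i) //= coefZ coefXn eqxx mulr1 big1 ?addr0 // => j ji.
  by rewrite coefZ coefXn eqSS (inj_eq val_inj) eq_sym (negPf ji) mulr0.
have m0 : 0 < Num.min e 1 by rewrite lt_min e0 ltr01.
have [|t [/andP[t0]]] := @poly_small_nonroot (\prod_(n <- s) P n) (Num.min e 1) _ m0.
  by rewrite prodf_seq_neq0; apply/allP => n /P0.
rewrite lt_min => /andP[te t1]; rewrite horner_prod prodf_seq_neq0 => /allP Pt.
exists (y + \row_(i < d.+1) t ^+ i.+1); split.
  move=> i; rewrite !mxE addrAC subrr add0r ger0_norm ?exprn_ge0 ?(ltW t0) //.
  by apply: le_lt_trans te; rewrite exprS ler_piMr ?exprn_ile1 // ltW.
move=> n /Pt /=; suff -> : (P n).[t] = dot n (y + \row_(i < d.+1) t ^+ i.+1 - x) by [].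
rewrite hornerD hornerC horner_sum addrAC [RHS]dotDr; congr (_ + _).
by apply: eq_bigr => i _; rewrite hornerZ hornerXn mxE.
Qed.

Lemma closed_cell_line xi a x v : xi a -> closed [set t : R | voronoi_cell xi a (x + t *: v)].
Proof.
move=> xa; rewrite [mkset _](_ : _ = \bigcap_(b in xi)
    [set t : R | pw x a - pw x b - t * (2 * (dot v a - dot v b)) <= 0]).
  apply: closed_bigI => b xb.
  apply: (@closed_comp _ _ (fun t : R => pw x a - pw x b - t * (2 * (dot v a - dot v b)))
    [set s | s <= 0]); last exact: closed_le.
  move=> t _; apply: cvgB; first exact: cvg_cst.
  by apply: cvgM; [exact: cvg_id | exact: cvg_cst].
apply/seteqP; split => t /=.
  move/(cellP _ xa) => H b xb; have := H b xb.
  by rewrite /= /pw !dotDl !dotZl; lra.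
move=> H; apply/(cellP _ xa) => b xb; have := H b xb.
by rewrite /= /pw !dotDl !dotZl; lra.
Qed.

Lemma cell_self xi a : xi a -> voronoi_cell xi a a.
Proof.
move=> xa; apply/(cellP _ xa) => b xb; rewrite -le_dist_pw.
rewrite [leLHS](_ : _ = 0) ?sqrtr_ge0 // /eucl_dist big1 ?sqrtr0 // => i _.
by rewrite subrr expr0n.
Qed.

(** The parameters in cells of nuclei reachable from [x] and those in the other cells of [S] form
    closed sets [CA] and [CB]. A common parameter would give an edge that extends reachability, so
    they are complementary in [[0, 1]]. Connectedness makes [CA] the whole interval, against the
    cell of [y] at parameter 1 if [y] is unreachable. *)
Lemma cells_path xi (S : seq V) x q y :
  (forall a, a \in S -> xi a) -> x \in S -> y \in S -> voronoi_cell xi y q ->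
  (forall t, 0 <= t <= 1 -> exists2 a, a \in S & voronoi_cell xi a (x + t *: (q - x))) ->
  (forall a b t, a \in S -> b \in S -> a != b -> 0 <= t <= 1 ->
     voronoi_cell xi a (x + t *: (q - x)) -> voronoi_cell xi b (x + t *: (q - x)) ->
     share_side (voronoi_cell xi a) (voronoi_cell xi b)) ->
  exists p, [/\ path (fun u v => `[< edge (voronoi_graph xi) u v >]) x p, uniq (x :: p),
    last x p = y & forall z, z \in x :: p -> z \in S].
Proof.
move=> Sxi xS yS yq cov sh.
pose e := fun u v => `[< edge (voronoi_graph xi) u v >].
pose P a := exists p, [/\ path e x p, last x p = a & forall z, z \in x :: p -> z \in S].
have [[p [pp lp pS]]|nP] := pselect (P y).
  move: lp; case/shortenP: pp => p' pp' up' sp' lp'; exists p'; split => // z.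
  rewrite inE => /predU1P[->//|/sp' zp]; apply: pS; by rewrite inE zp orbT.
pose L a := [set t : R | voronoi_cell xi a (x + t *: (q - x))].
have cL a : a \in S -> closed (L a) by move=> aS; apply: closed_cell_line; exact: Sxi.
pose A := [seq a <- S | `[< P a >]]; pose B := [seq a <- S | ~~ `[< P a >]].
pose CA := \big[setU/set0]_(a <- A) L a; pose CB := \big[setU/set0]_(a <- B) L a.
have clA : closed CA by apply: closed_bigsetU => a; rewrite mem_filter => /andP[_]; exact: cL.
have clB : closed CB by apply: closed_bigsetU => a; rewrite mem_filter => /andP[_]; exact: cL.
have CP (s : seq V) t : (\big[setU/set0]_(a <- s) L a) t <-> exists2 a, a \in s & L a t.
  by rewrite -bigcup_seq; split=> [[a]|[a]]; exists a.
have AB : `[0, 1]%classic `&` CA = `[0, 1]%classic `&` ~` CB.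
  apply/seteqP; split => t [/= t01 tC]; split => //.
    move=> /CP[b]; rewrite mem_filter => /andP[/asboolPn nPb bS] bt.
    move: tC => /CP[a]; rewrite mem_filter => /andP[/asboolP [p [pp lp pS]] aS] at_.
    have [ab|ab] := eqVneq a b; first by apply: nPb; rewrite -ab; exists p.
    apply: nPb; exists (rcons p b); split; rewrite ?last_rcons //.
      rewrite rcons_path pp lp /=; apply/asboolP; split; [exact: Sxi|exact: Sxi|exact/eqP|].
      by apply: (sh _ _ t) => //; move: t01; rewrite in_itv.
    by move=> z; rewrite -rcons_cons mem_rcons inE => /predU1P[->//|]; exact: pS.
  move: (t01); rewrite in_itv /= => /cov[a aS at_].
  have [Pa|nPa] := boolP `[< P a >]; first by apply/CP; exists a => //; rewrite mem_filter Pa.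
  by exfalso; apply: tC; apply/CP; exists a => //; rewrite mem_filter nPa.
have E : `[0, 1]%classic `&` CA = `[0, 1]%classic.
  apply: segment_connected.
  - exists 0; split; first by rewrite /= in_itv /= lexx ler01.
    apply/CP; exists x; last by rewrite /L /= scale0r addr0; apply: cell_self; exact: Sxi.
    rewrite mem_filter xS andbT; apply/asboolP; exists [::]; split => // z.
    by rewrite inE => /eqP->.
  - by exists (~` CB) => //; rewrite openC.
  - by exists CA.
have : (`[0, 1]%classic `&` CA) 1 by rewrite E /= in_itv /= lexx ler01.
rewrite AB => -[_]; case; apply/CP; exists y; last by rewrite /L /= scale1r addrC subrK.
by rewrite mem_filter yS andbT; apply/asboolPn.
Qed.

End VoronoiPath.

Lemma seq_argmin (R : realType) (T : eqType) (f : T -> R) (s : seq T) c : c \in s ->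
  exists2 a, a \in s & forall b, b \in s -> f a <= f b.
Proof.
case: s => // a0 s _; elim: s a0 => [|a1 s IH] a0.
  by exists a0; rewrite ?mem_head // => b; rewrite inE => /eqP->.
have [a aS am] := IH a1; have [le0|lt0] := leP (f a0) (f a).
  exists a0; rewrite ?mem_head // => b; rewrite inE => /predU1P[->//|/am].
  exact: le_trans.
exists a; first by rewrite inE aS orbT.
by move=> b; rewrite inE => /predU1P[->|/am//]; exact: ltW.
Qed.

Section VoronoiSegment.
Variables (R : realType) (d : nat).
Local Notation V := 'rV[R]_d.+1.
Implicit Types (a b u v x y z : V) (xi F : set V).

Lemma pw_sub z a b : pw z a - pw z b = dot (z - a) (z - a) - dot (z - b) (z - b).
Proof.
by rewrite /pw !(dotDl, dotDr, dotNl, dotNr) (dotC a z) (dotC b z); ring.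
Qed.

Lemma cell_nucleus xi a x : xi x -> xi a -> voronoi_cell xi a x -> a = x.
Proof.
move=> xx xa /(cellP _ xa)/(_ _ xx); rewrite -subr_le0 pw_sub subrr.
rewrite -(scale0r 0) dotZl mul0r subr0 => le0.
have : dot (x - a) (x - a) == 0 by rewrite eq_le le0 dot_ge0.
by rewrite dot_eq0 subr_eq0 => /eqP.
Qed.

Lemma dot_sqr_le u (r : R) : (forall i, `|u 0 i| <= r) -> dot u u <= d.+1%:R * r ^+ 2.
Proof.
move=> ur; rewrite /dot (le_trans (ler_sum _ (_ : forall i, _ -> _ <= r ^+ 2))) //.
  by move=> i _; rewrite -expr2 -real_normK ?num_real // lerXn2r ?nnegrE ?(le_trans _ (ur i)).
by rewrite sumr_const card_ord mulr_natl.
Qed.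

Lemma dot_sqr_ge u i : (u 0 i) ^+ 2 <= dot u u.
Proof.
rewrite /dot (bigD1 i) //= -expr2 lerDl; apply: sumr_ge0 => j _.
by rewrite -expr2 sqr_ge0.
Qed.

(** The squared distance from [z] to [x] is at most [d.+1 * (2 * r) ^ 2], while a single coordinate
    of [z - a] exceeds [d.+1 * (2 * r) + 1]. Hence only finitely many nuclei of a configuration
    compete for the points of a bounded segment. *)
Lemma far_point (r : R) x z a : 0 <= r -> (forall i, `|x 0 i| <= r) -> (forall i, `|z 0 i| <= r) ->
  ~ cube (r + d.+1%:R * (2 * r) + 1) a -> pw z x < pw z a.
Proof.
move=> r0 xr zr aB; rewrite -subr_lt0 pw_sub subr_lt0.
have [i ai] : exists i, r + d.+1%:R * (2 * r) + 1 < `|a 0 i|.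
  apply: contrapT => H; apply: aB => i; rewrite -ler_norml leNgt.
  by apply/negP => ?; apply: H; exists i.
apply: le_lt_trans (_ : d.+1%:R * (2 * r) ^+ 2 < _).
  apply: dot_sqr_le => j; rewrite !mxE mulr2n mulrDl mul1r.
  by rewrite (le_trans (ler_normB _ _)) // lerD.
apply: lt_le_trans (dot_sqr_ge _ i); rewrite !mxE -(@real_normK _ (_ - _)) ?num_real //.
have : d.+1%:R * (2 * r) + 1 < `|z 0 i - a 0 i|.
  have := lerB_dist (a 0 i) (z 0 i); rewrite distrC; have := zr i; lra.
have : 1 <= d.+1%:R :> R by rewrite ler1n.
set D := d.+1%:R; set w := `|_|; move=> D1 Dw.
have r2 : 0 <= 2 * r by lra.
have Dr : 0 <= D * (2 * r) by rewrite mulr_ge0 // (le_trans ler01).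
have : D * (2 * r) ^+ 2 <= (D * (2 * r)) ^+ 2.
  by rewrite [leRHS]exprMn ler_wpM2r ?sqr_ge0 // expr2 ler_peMl // (le_trans ler01).
nra.
Qed.

(** At [y] itself each [b != y] loses by [c > 0]; moving by less than [c / (2 * s + 1)] in every
    coordinate changes this gap by at most [c]. *)
Lemma near_nucleus y (S : seq V) : exists e : R, 0 < e /\
  forall q : V, (forall i, `|q 0 i - y 0 i| < e) -> forall b, b \in S -> pw q y <= pw q b.
Proof.
elim: S => [|b S [e [e0 IH]]]; first by exists 1; split.
have [<-|yb] := eqVneq y b.
  by exists e; split => // q /IH H c; rewrite inE => /predU1P[->//|/H].
have c0 : 0 < dot (y - b) (y - b) by rewrite lt_def dot_ge0 dot_eq0 subr_eq0 yb.
set c := dot _ _ in c0; pose s := \sum_(i < d.+1) `|y 0 i - b 0 i|.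
have s0 : 0 <= s by exact: sumr_ge0.
exists (Num.min e (c / (2 * s + 1))); split.
  by rewrite lt_min e0 divr_gt0 //; lra.
move=> q qy a; rewrite inE => /predU1P[->|aS]; last first.
  by apply: IH aS => i; apply: lt_le_trans (qy i) _; rewrite ge_min lexx.
have : `|dot (q - y) (y - b)| <= c / (2 * s + 1) * s.
  rewrite (le_trans (ler_norm_sum _ _ _)) // mulr_sumr; apply: ler_sum => i _.
  rewrite normrM !mxE. rewrite ler_wpM2r // ltW // (lt_le_trans (qy i)) // ge_min.
  by rewrite lexx orbT.
have : c / (2 * s + 1) * (2 * s) <= c.
  rewrite -mulrA ler_piMr ?(ltW c0) // mulrC ler_pdivrMr; lra.
rewrite ler_norml => h1 /andP[h2 h3]; rewrite -subr_le0.
have -> : pw q y - pw q b = - (2 * dot (q - y) (y - b) + c).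
  rewrite /c /pw !(dotDl, dotDr, dotNl, dotNr) (dotC b y); ring.
rewrite oppr_le0; move: (c / _) h1 h2 h3 => k; lra.
Qed.

(** Only the nuclei in [S0] can own a point of the segment. For each pair of them whose common
    points lie in a hyperplane through [x], the endpoint [q] is taken off such a hyperplane, which
    the segment then meets only at [x]. *)
Lemma voronoi_path xi x y (e : R) : configuration xi -> xi x -> xi y -> 0 < e ->
  exists q : V, (forall i, `|q 0 i - y 0 i| < e) /\
  exists p, [/\ path (fun u v => `[< edge (voronoi_graph xi) u v >]) x p, uniq (x :: p),
    last x p = y &
    forall z, z \in x :: p -> xi z /\
      exists t : R, 0 <= t <= 1 /\ voronoi_cell xi z (x + t *: (q - x))].
Proof.
move=> cxi xx xy e0.
pose rho := 1 + \sum_i `|x 0 i| + \sum_i `|y 0 i|.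
have sx i : `|x 0 i| <= \sum_i `|x 0 i|.
  by rewrite (bigD1 i) //= lerDl sumr_ge0.
have sy i : `|y 0 i| <= \sum_i `|y 0 i|.
  by rewrite (bigD1 i) //= lerDl sumr_ge0.
have sx0 : 0 <= \sum_i `|x 0 i| by exact: sumr_ge0.
have sy0 : 0 <= \sum_i `|y 0 i| by exact: sumr_ge0.
have rho0 : 0 <= rho by rewrite /rho; lra.
have xr i : `|x 0 i| <= rho by have := sx i; rewrite /rho; lra.
have yr i : `|y 0 i| + 1 <= rho by have := sy i; rewrite /rho; lra.
pose B := rho + d.+1%:R * (2 * rho) + 1.
have /finite_seqP[S0 S0E] := cxi B.
have S0xi a : a \in S0 -> xi a.
  by move=> aS; have [] : (xi `&` cube B) a by rewrite S0E.
have rB : rho <= B.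
  by rewrite /B -addrA lerDl addr_ge0 // mulr_ge0 // mulr_ge0.
have inS0 a : xi a -> (forall i, `|a 0 i| <= rho) -> a \in S0.
  move=> xa ar; have : (xi `&` cube B) a by split=> // i; rewrite -ler_norml (le_trans (ar i)).
  by rewrite S0E.
have xS0 : x \in S0 by exact: inS0.
have yS0 : y \in S0 by apply: inS0 => // i; have := yr i; lra.
have [eta [eta0 Heta]] := near_nucleus y S0.
pose hyp (ab : V * V) n := n != 0 /\
  forall f, (voronoi_cell xi ab.1 `&` voronoi_cell xi ab.2) f -> dot n (f - x) = 0.
(* Pairs without such a hyperplane get the dummy normal 0, which may fail [hyp]; zero normals are
   filtered out of [s]. *)
have /boolp.choice[nn nnP] : forall ab, exists n, (exists n', hyp ab n') -> hyp ab n.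
  move=> ab; have [[n hn]|nh] := pselect (exists n', hyp ab n'); first by exists n.
  by exists 0.
pose s := [seq n <- [seq nn (a, b) | a <- S0, b <- S0] | n != 0].
(* The bound [e] is the requested accuracy, 1 keeps [q] within [rho], and [eta] keeps [q] in the
   cell of [y]. *)
have m0 : 0 < Num.min (Num.min e 1) eta by rewrite !lt_min e0 ltr01.
have [|q [qy qs]] := @generic_point R d s x y _ m0.
  by move=> n; rewrite mem_filter => /andP[].
exists q; split.
  by move=> i; apply: lt_le_trans (qy i) _; rewrite !ge_min lexx.
have qr i : `|q 0 i| <= rho.
  have : `|q 0 i - y 0 i| < 1.
    by apply: lt_le_trans (qy i) _; rewrite !ge_min lexx orbT.
  have := lerB_dist (q 0 i) (y 0 i); have := yr i; lra.
have zr (t : R) : 0 <= t <= 1 -> forall i, `|(x + t *: (q - x)) 0 i| <= rho.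
  move=> /andP[t0 t1] i; rewrite !mxE.
  have := xr i; have := qr i; rewrite !ler_norml => /andP[q1 q2] /andP[x1 x2].
  by apply/andP; split; nra.
pose S := [seq a <- S0 | `[< exists t : R, 0 <= t <= 1 /\ voronoi_cell xi a (x + t *: (q - x)) >]].
have yq : voronoi_cell xi y q.
  apply/(cellP _ xy) => b xb; have [cb|ncb] := pselect (cube B b).
    apply: Heta; last by have : (xi `&` cube B) b by []; rewrite S0E.
    by move=> i; apply: lt_le_trans (qy i) _; rewrite !ge_min lexx !orbT.
  by apply/ltW/(far_point rho0) => // i; have := yr i; lra.
have [|||||p [pp up lp pS]] := @cells_path R d xi S x q y _ _ _ yq.
- by move=> a; rewrite mem_filter => /andP[_]; exact: S0xi.
- rewrite mem_filter xS0 andbT; apply/asboolP; exists 0; rewrite lexx ler01; split => //.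
  by rewrite scale0r addr0; exact: cell_self.
- rewrite mem_filter yS0 andbT; apply/asboolP; exists 1; rewrite lexx ler01; split => //.
  by rewrite scale1r addrC subrK.
- move=> t t01; have [a aS am] := seq_argmin (pw (x + t *: (q - x))) xS0.
  have ca : voronoi_cell xi a (x + t *: (q - x)).
    apply/(cellP _ (S0xi _ aS)) => b xb; have [cb|ncb] := pselect (cube B b).
      by apply: am; have : (xi `&` cube B) b by []; rewrite S0E.
    by apply: le_trans (am _ xS0) _; apply/ltW/(far_point rho0) => //; exact: zr.
  by exists a => //; rewrite mem_filter aS andbT; apply/asboolP; exists t.
- move=> a b t; rewrite !mem_filter => /andP[_ aS] /andP[_ bS] ab t01 at_ bt.
  have xa := S0xi _ aS; have xb := S0xi _ bS.
  have [//|[n n0 nF]] := share_side_or_hyperplane x xa xb ab.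
  have [m0' mF] : hyp (a, b) (nn (a, b)) by apply: nnP; exists n.
  (* Since [q] is off the hyperplane, the common point has [t = 0]: it is [x], which belongs to no
     cell but its own. *)
  have := mF _ (conj at_ bt); rewrite addrAC subrr add0r dotZr => /eqP.
  rewrite mulf_eq0 (negPf (qs _ _)) ?orbF; last first.
    by rewrite mem_filter m0' /=; apply/allpairsP; exists (a, b).
  move=> /eqP t0; move: at_ bt; rewrite t0 scale0r addr0.
  move=> /(cell_nucleus xx xa) ax /(cell_nucleus xx xb) bx.
  by move: ab; rewrite ax bx eqxx.
exists p; split => // z /pS; rewrite mem_filter => /andP[/asboolP ? /S0xi].
by split.
Qed.

End VoronoiSegment.

(** * Boxes and Poisson estimates *)

Section Boxes.
Variables (R : realType) (n : nat) (c : nat) (L : R).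
Hypothesis L0 : 0 < L.

(** The shift by [c] centres the grid at the origin when [n = 2 * c]; half-open intervals make the
    boxes disjoint. *)
Definition box_itv (k : nat) : interval R :=
  `[(k%:R - c%:R) * L, (k.+1%:R - c%:R) * L[.

Definition box d (u : {ffun 'I_d -> 'I_n}) : set 'rV[R]_d :=
  [set z | forall i, z 0 i \in box_itv (u i)].

Definition boxes d (U : {set {ffun 'I_d -> 'I_n}}) : set 'rV[R]_d :=
  [set z | exists2 u, u \in U & box u z].

Lemma box_itv_eq (k l : nat) (x : R) : x \in box_itv k -> x \in box_itv l -> k = l.
Proof.
wlog kl : k l / (k <= l)%N => [H|] xk xl.
  by case/orP: (leq_total k l) => [/H|/H h]; [exact | apply/esym/h].
apply/eqP; rewrite eqn_leq kl /= leqNgt; apply/negP => lk.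
move: xk xl; rewrite !in_itv /= => /andP[_ h1] /andP[h2 _].
have := le_lt_trans h2 h1; rewrite ltr_pM2r // ltrD2r ltr_nat.
by rewrite ltnNge lk.
Qed.

Lemma volume_ext d (A B : set 'rV[R]_d) : A `<=>` B -> volume A = volume B.
Proof. by move=> /seteqP ->. Qed.

Section Cons.
Variable d : nat.

Definition fcons (k : 'I_n) (v : {ffun 'I_d -> 'I_n}) : {ffun 'I_d.+1 -> 'I_n} :=
  [ffun i => if unlift ord0 i is Some j then v j else k].

Lemma row_mx_head (x : R) (y : 'rV_d) :
  (row_mx (const_mx x : 'rV[R]_1) y : 'rV[R]_d.+1) 0 ord0 = x.
Proof. by rewrite mxE; case: splitP => // j _; rewrite mxE. Qed.

Lemma row_mx_tail (x : R) (y : 'rV_d) i :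
  (row_mx (const_mx x : 'rV[R]_1) y : 'rV[R]_d.+1) 0 (lift ord0 i) = y 0 i.
Proof.
rewrite mxE; case: splitP => [j|j [] /val_inj ->//]; by case: j => -[].
Qed.

Lemma box_row_mx (x : R) (y : 'rV_d) k v :
  box (fcons k v) (row_mx (const_mx x : 'rV[R]_1) y : 'rV[R]_d.+1) <-> x \in box_itv k /\ box v y.
Proof.
split=> [H|[xk H] i].
  split=> [|i]; first by have := H ord0; rewrite ffunE unlift_none row_mx_head.
  by have := H (lift ord0 i); rewrite ffunE liftK row_mx_tail.
by rewrite ffunE; case: unliftP => [j ->|->]; rewrite (row_mx_tail, row_mx_head).
Qed.

Definition slice (U : {set {ffun 'I_d.+1 -> 'I_n}}) (k : 'I_n) : {set {ffun 'I_d -> 'I_n}} :=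
  finset (fun v => fcons k v \in U).

Lemma fcons_eta (u : {ffun 'I_d.+1 -> 'I_n}) :
  fcons (u ord0) [ffun i => u (lift ord0 i)] = u.
Proof. by apply/ffunP => i; rewrite ffunE; case: unliftP => [j ->|->]; rewrite ?ffunE. Qed.

Lemma card_slices (U : {set {ffun 'I_d.+1 -> 'I_n}}) : (\sum_k #|slice U k|)%N = #|U|.
Proof.
under eq_bigr do rewrite -sum1_card.
rewrite pair_big_dep /= -sum1_card (reindex (fun kv => fcons kv.1 kv.2)) /=.
  by apply: eq_bigl => -[k v]; rewrite inE.
exists (fun u => (u ord0, [ffun i => u (lift ord0 i)])) => [[k v] _|u _] /=; last exact: fcons_eta.
by rewrite ffunE unlift_none; congr (_, _); apply/ffunP => i; rewrite !ffunE liftK.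
Qed.

Lemma boxes_row_mx U (x : R) (y : 'rV_d) :
  boxes U (row_mx (const_mx x : 'rV[R]_1) y : 'rV[R]_d.+1) <->
  exists k, x \in box_itv (k : 'I_n) /\ boxes (slice U k) y.
Proof.
split=> [[u uU]|[k [xk [v]]]].
  rewrite -(fcons_eta u) => /box_row_mx[xk yv]; exists (u ord0); split => //.
  by exists [ffun i => u (lift ord0 i)]; rewrite // inE fcons_eta.
by rewrite inE => kv yv; exists (fcons k v) => //; apply/box_row_mx.
Qed.

End Cons.

Lemma volume0 d : volume (set0 : set 'rV[R]_d) = 0%E.
Proof.
elim: d => [|d IH] /=; first by rewrite indic0.
by rewrite integral0_eq // => x _; exact: IH.
Qed.

(** Induction along the recursion of [volume]: for [x] in the interval [k] the section is the union
    of the boxes of [slice U k], and off the grid it is empty. *)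
Lemma volume_boxes d (U : {set {ffun 'I_d -> 'I_n}}) :
  volume (boxes U) = (#|U|%:R * L ^+ d)%:E.
Proof.
elim: d U => [|d IH] U /=.
  congr (_%:E); rewrite expr0 mulr1 indicE; have [->|] := set_0Vmem U.
    by rewrite cards0 memNset // => -[u]; rewrite inE.
  case=> u uU; rewrite mem_set; last by exists u => // -[].
  suff -> : U = finset.set1 u by rewrite cards1.
  apply/finset.setP => v; rewrite inE (_ : v = u) ?uU ?eqxx //; apply/ffunP => -[] //.
transitivity (\int[@lebesgue_measure R]_x
    \sum_(k < n) ((#|slice U k|%:R * L ^+ d) * \1_[set` box_itv k] x)%:E)%E.
  apply: eq_integral => x _; have [[k xk]|nx] := pselect (exists k : 'I_n, x \in box_itv k).
    transitivity (volume (boxes (slice U k))).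
      apply: volume_ext; split=> y /=; rewrite boxes_row_mx; last by exists k.
      by case=> l [/(box_itv_eq xk)/val_inj <-].
    rewrite IH (bigD1 k) //= indicE mem_set // mulr1 big1 ?adde0 // => l lk.
    rewrite indicE memNset ?mulr0 // => /= /(box_itv_eq xk)/val_inj kl.
    by rewrite kl eqxx in lk.
  transitivity (volume (set0 : set 'rV[R]_d)).
    apply: volume_ext; split=> y //=; rewrite boxes_row_mx => -[k [xk _]].
    by apply: nx; exists k.
  rewrite volume0 big1 // => k _; rewrite indicE memNset ?mulr0 // => xk.
  by apply: nx; exists k.
rewrite ge0_integral_sum //=; last 2 first.
- move=> k; apply/measurable_EFinP; apply: measurable_funM => //.
- by move=> k x _; rewrite lee_fin mulr_ge0 // mulr_ge0 // exprn_ge0 // ltW.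
rewrite -card_slices natr_sum mulr_suml -sumEFin; apply: eq_bigr => k _.
under eq_integral do rewrite EFinM.
rewrite ge0_integralZl_EFin //=; last 2 first.
- by apply/measurable_EFinP.
- by rewrite mulr_ge0 // exprn_ge0 // ltW.
rewrite integral_indic //= setIT lebesgue_measure_itv /= lte_fin ltr_pM2r // ltrD2r ltr_nat leqnn.
rewrite -EFinB -EFinM exprS; congr (_%:E).
by rewrite -natr1; ring.
Qed.

End Boxes.

(** * Poisson tails and void probabilities *)

Section PoissonBounds.
Variable R : realType.

Lemma coord_set_borel d (i : 'I_d) (A : set R) : open A \/ closed A ->
  borel_set [set z : 'rV[R]_d | A (z 0 i)].
Proof.
pose G := [set U : set 'rV[R]_d | open U].
have cz : continuous (fun z : 'rV[R]_d => z 0 i) by exact: coord_continuous.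
case=> [oA|cA]; first by apply: sub_sigma_algebra; exact: (open_comp (fun z _ => cz z) oA).
rewrite -[X in borel_set X]setCK.
apply: (@measurableC _ (g_sigma_algebraType G)).
apply: sub_sigma_algebra; apply: closed_openC.
exact: (closed_comp (fun z _ => cz z) cA).
Qed.

Lemma borel_boxes n c (L : R) d (U : {set {ffun 'I_d -> 'I_n}}) : borel_set (boxes c L U).
Proof.
pose G := [set U : set 'rV[R]_d | open U].
have -> : boxes c L U = \bigcup_(u in [set u | u \in U]) box c L u.
  by apply/seteqP; split=> z /= [u uU uz]; exists u.
apply: (@fin_bigcup_measurable _ (g_sigma_algebraType G)) => // u _.
have -> : box c L u = \bigcap_(i in [set: 'I_d]) [set z | z 0 i \in box_itv c L (u i)].
  by apply/seteqP; split=> z /= H i => [_|]; exact: H.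
apply: (@fin_bigcap_measurable _ (g_sigma_algebraType G)) => // i _.
suff : borel_set [set z : 'rV[R]_d | z 0 i \in box_itv c L (u i)] by [].
have -> : [set z : 'rV[R]_d | z 0 i \in box_itv c L (u i)] =
    [set z | [set x | ((u i)%:R - c%:R) * L <= x] (z 0 i)] `&`
    [set z | [set x | x < ((u i).+1%:R - c%:R) * L] (z 0 i)].
  by apply/seteqP; split=> z /=; rewrite in_itv /= => /andP.
apply: (@measurableI _ (g_sigma_algebraType G)); apply: coord_set_borel.
  by right; exact: closed_ge.
by left; exact: open_lt.
Qed.

Lemma exp_partial_sum (v : R) n : 0 <= v -> \sum_(k < n) v ^+ k / k`!%:R <= expR v.
Proof.
move=> v0; rewrite -(big_mkord xpredT (fun k => v ^+ k / k`!%:R)).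
apply: (nondecreasing_cvgn_le (u_ := series (exp_coeff v))).
  apply: nondecreasing_series => k _ _.
  by rewrite /exp_coeff /= divr_ge0 ?exprn_ge0.
exact: is_cvg_series_exp_coeff.
Qed.

(** A Chernoff bound with factor 4: [v ^+ k <= 4 ^- s * (4 * v) ^+ k] for [k >= s], summed over
    partial sums. *)
Lemma exp_tail (v : R) s : 0 <= v ->
  expR v - \sum_(k < s) v ^+ k / k`!%:R <= 4 ^- s * expR (4 * v).
Proof.
move=> v0; rewrite lerBlDr /expR; apply: limr_le; first exact: is_cvg_series_exp_coeff.
exists s => // N /= sN; rewrite /series /= big_mkord.
have -> : \sum_(k < N) exp_coeff v k = \sum_(s <= k < N) v ^+ k / k`!%:R + \sum_(k < s) v ^+ k / k`!%:R.
  rewrite -(big_mkord xpredT (exp_coeff v)) (big_cat_nat (leq0n s) sN) //= addrC; congr (_ + _).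
  by rewrite big_mkord.
rewrite lerD2r -/(expR (4 * v)).
have : \sum_(k < N) (4 * v) ^+ k / k`!%:R <= expR (4 * v) by rewrite exp_partial_sum // mulr_ge0.
move=> /(ler_wpM2l (_ : 0 <= 4 ^- s)); rewrite invr_ge0 exprn_ge0 // => /(_ isT).
apply: le_trans; rewrite -(big_mkord xpredT (fun k => (4 * v) ^+ k / k`!%:R)).
rewrite (big_cat_nat (leq0n s) sN) //= mulrDr.
apply: le_trans (_ : 4 ^- s * \sum_(s <= k < N) (4 * v) ^+ k / k`!%:R <= _); last first.
  rewrite lerDr mulr_ge0 ?invr_ge0 ?exprn_ge0 // sumr_ge0 // => k _.
  by rewrite divr_ge0 // exprn_ge0 // mulr_ge0.
rewrite mulr_sumr big_nat [leRHS]big_nat; apply: ler_sum => k /andP[sk _].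
rewrite mulrA ler_wpM2r // exprMn mulrA ler_peMl ?exprn_ge0 //.
by rewrite mulrC ler_pdivlMr ?exprn_gt0 // mul1r ler_weXn2l // ler1n.
Qed.

Variables (d : nat) (disp : measure_display) (Omega : measurableType disp).
Variables (P : probability Omega R) (eta : Omega -> set 'rV[R]_d).
Hypothesis peta : poisson_process P eta.

(** The complement of finitely many count events is measurable by the Poisson axioms, and it
    includes infinite counts. *)
Definition atleast (B : set 'rV[R]_d) (s : nat) : set Omega :=
  ~` \big[setU/set0]_(k < s) count_event eta B k.

Lemma measurable_atleast B s : borel_set B -> measurable (atleast B s).
Proof.
move=> bB; apply: measurableC; apply: bigsetU_measurable => k _.
exact: (poisson_measurable peta).
Qed.

Lemma poisson_tail B s v : borel_set B -> volume B = v%:E -> 0 <= v ->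
  (P (atleast B s) <= (4 ^- s * expR (4 * v))%:E)%E.
Proof.
move=> bB Bv v0.
have mk k : measurable (count_event eta B k) by exact: (poisson_measurable peta).
have pk k : P (count_event eta B k) = (expR (- v) * (v ^+ k / k`!%:R))%:E.
  by rewrite (poisson_law peta) ?Bv ?ltry //= mulrA.
rewrite probability_setC; last by apply: bigsetU_measurable.
rewrite measure_semi_additive_ord //=; last 2 first.
- apply/trivIsetP => i j _ _ ij; apply/seteqP; split => // w [/= wi wj].
  apply: (negP ij); apply/eqP/val_inj/eqP; rewrite eqn_leq -!card_le_II.
  have e : (`I_i #= `I_j)%card.
    by move: wi wj; rewrite /count_event /= card_eq_sym; exact: card_eq_trans.
  by have := e; rewrite card_eq_le.
- exact: bigsetU_measurable.
under eq_bigr do rewrite pk.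
rewrite sumEFin -EFinB lee_fin -mulr_sumr.
have e1 : expR (- v) <= 1 by rewrite -expR0 ler_expR oppr_le0.
have -> : 1 - expR (- v) * (\sum_(i < s) v ^+ i / i`!%:R)
   = expR (- v) * (expR v - \sum_(i < s) v ^+ i / i`!%:R).
  by rewrite mulrBr -expRD addNr expR0.
apply: le_trans (ler_wpM2l (expR_ge0 _) (exp_tail s v0)) _.
by rewrite ler_piMl // mulr_ge0 ?expR_ge0 // invr_ge0 exprn_ge0.
Qed.

Lemma poisson_void B v : borel_set B -> volume B = v%:E ->
  P (count_event eta B 0) = (expR (- v))%:E.
Proof. by move=> bB Bv; rewrite (poisson_law peta) ?Bv ?ltry //= divr1 mulr1. Qed.

Lemma union_bound (As : seq (set Omega)) (b : R) :
  (forall A, A \in As -> measurable A /\ (P A <= b%:E)%E) ->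
  measurable (\big[setU/set0]_(A <- As) A) /\
  (P (\big[setU/set0]_(A <- As) A) <= ((size As)%:R * b)%:E)%E.
Proof.
elim: As => [|A As IH] H; first by rewrite big_nil measure0 mul0r; split.
have [mA PA] := H A (mem_head _ _).
have [|mS PS] := IH; first by move=> A' A's; apply: H; rewrite inE A's orbT.
rewrite big_cons; split; first exact: measurableU.
apply: le_trans (measureU2 _ _ _) _ => //.
rewrite /= -natr1 mulrDl mul1r addrC EFinD.
exact: leeD.
Qed.

End PoissonBounds.

Section Walks.
Variables (d n : nat).
Local Notation T := {ffun 'I_d -> 'I_n}.

Fixpoint walks (k : nat) (x : T) : seq (seq T) :=
  if k is k'.+1 then flatten [seq [seq y :: p | p <- walks k' y] | y <- enum (gball x 1)]
  else [:: [::]].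

Lemma size_flatten_map_le (A B : eqType) (f : A -> seq B) (s : seq A) (b : nat) :
  (forall i, i \in s -> (size (f i) <= b)%N) ->
  (size (flatten [seq f i | i <- s]) <= size s * b)%N.
Proof.
elim: s => //= i s IH H; rewrite size_cat mulSn leq_add ?H ?mem_head //.
by apply: IH => j js; rewrite H // inE js orbT.
Qed.

Lemma size_walks k x : (size (walks k x) <= (3 ^ d) ^ k)%N.
Proof.
elim: k x => [|k IH] x //=; rewrite expnS.
apply: leq_trans (leq_mul (card_gball_le x 1) (leqnn _)).
rewrite [in X in (_ <= X)%N]cardE; apply: size_flatten_map_le => y _.
by rewrite size_map.
Qed.

Lemma mem_walks (x : T) p : path (near 1) x p -> p \in walks (size p) x.
Proof.
elim: p x => //= y p IH x /andP[xy yp]; apply/flatten_mapP; exists y.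
  by rewrite mem_enum inE.
by apply: map_f; exact: IH.
Qed.

End Walks.

(** * Peierls estimates *)

Section GoodEvents.
Variables (R : realType) (d n c : nat) (L : R).
Hypothesis L0 : 0 < L.
Variables (disp : measure_display) (Omega : measurableType disp).
Variables (P : probability Omega R) (eta : Omega -> set 'rV[R]_d).
Hypothesis peta : poisson_process P eta.
Local Notation T := {ffun 'I_d -> 'I_n}.

Definition occ (w : Omega) (v : T) : bool := `[< exists z, eta w z /\ box c L v z >].

Lemma natr_expR (k : nat) : k%:R <= expR k%:R :> R.
Proof. by apply: le_trans (expR_ge1Dx _); rewrite lerDr. Qed.

Lemma natrX_expR (k l : nat) : (k ^ l)%:R <= expR (l * k)%:R :> R.
Proof.
by rewrite natrM expRM_natl natrX lerXn2r ?nnegrE ?expR_ge0 // natr_expR.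
Qed.

(** There are at most [#|T| * (3 ^ d) ^ k.*2] walk supports of size [k] and [2 ^ k] choices of the
    vacant part [E]. Each [E] with [k <= 2 * C * #|E|] is vacant with probability
    [exp (- #|E| L ^ d)], at most [exp (- k (2 * 3 ^ d + 3))], which beats the count. *)
Lemma sparse_event (C m : nat) : (0 < m)%N -> (0 < C)%N ->
  2 * C%:R * (2 * (3 ^ d)%:R + 3) <= L ^+ d ->
  exists A : set Omega, [/\ measurable A,
    (P A <= (#|T|%:R * (#|T|%:R * expR (- (2 * m%:R))))%:E)%E &
    forall w, ~ A w -> forall (x : T) p, path (near 1) x p ->
      let U := finset (fun y => y \in x :: p) in
      size p = #|U|.-1.*2 -> (m <= #|U|)%N ->
      (2 * C * #|finset (fun v => (v \in U) && ~~ occ w v)| < #|U|)%N].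
Proof.
move=> m0 C0 HL.
pose Ws k := [seq U <- flatten [seq [seq finset (fun y => y \in x :: p) | p <- walks k.-1.*2 x]
  | x <- enum T] | #|U : {set T}| == k].
pose Es k := [seq E <- flatten [seq enum (powerset U) | U <- Ws k] | (k <= 2 * C * #|E : {set T}|)%N].
have sWs k : (size (Ws k) <= #|T| * (3 ^ d) ^ k.*2)%N.
  apply: leq_trans (_ : (_ <= #|T| * (3 ^ d) ^ k.-1.*2)%N) _; last first.
    rewrite leq_mul2l; apply/orP; right; apply: leq_pexp2l; first by rewrite expn_gt0.
    by rewrite leq_double leq_pred.
  rewrite size_filter; apply: leq_trans (count_size _ _) _; rewrite cardE.
  by apply: size_flatten_map_le => x _; rewrite size_map size_walks.
have sEs k : (size (Es k) <= #|T| * (3 ^ d) ^ k.*2 * 2 ^ k)%N.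
  rewrite size_filter; apply: leq_trans (count_size _ _) _.
  apply: leq_trans (leq_mul (sWs k) (leqnn _)); apply: size_flatten_map_le => U.
  by rewrite mem_filter => /andP[/eqP <- _]; rewrite -cardE card_powerset.
pose void (E : {set T}) := count_event eta (boxes c L E) 0.
pose bad k := \big[setU/set0]_(A <- [seq void E | E <- Es k]) A.
have badP k : measurable (bad k) /\ (P (bad k) <= (#|T|%:R * expR (- (2 * k%:R)))%:E)%E.
  have [|mb Pb] := @union_bound R _ _ P [seq void E | E <- Es k]
      (expR (- (k%:R * (2 * (3 ^ d)%:R + 3)))).
    move=> A /mapP[E + ->]; rewrite mem_filter => /andP[kE _].
    have bE := borel_boxes c L E; split; first exact: (poisson_measurable peta).
    rewrite (poisson_void peta bE (volume_boxes c L0 E)) lee_fin ler_expR lerN2.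
    apply: le_trans (_ : (2 * C * #|E|)%:R * (2 * (3 ^ d)%:R + 3) <= _).
      by rewrite ler_wpM2r ?ler_nat // addr_ge0 // mulr_ge0.
    have := ler_wpM2l (ler0n R #|E|) HL; rewrite (natrM _ (2 * C)%N) (natrM _ 2).
    by move: (3 ^ d)%:R (L ^+ d) (#|E|%:R) => D l e; lra.
  split => //; apply: le_trans Pb _; rewrite lee_fin size_map.
  apply: le_trans (_ : (#|T| * (3 ^ d) ^ k.*2 * 2 ^ k)%:R * expR (- (k%:R * (2 * (3 ^ d)%:R + 3))) <= _).
    by rewrite ler_wpM2r ?expR_ge0 // ler_nat.
  rewrite -mulnA natrM -mulrA ler_wpM2l // natrM.
  (* By [3 ^ d <= exp (3 ^ d)] and [2 <= exp 1] the count costs the exponent [2 * k * 3 ^ d + k],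
     and [- 2 * k] remains. *)
  apply: le_trans (_ : expR (k.*2 * 3 ^ d)%:R * expR k%:R * expR (- (k%:R * (2 * (3 ^ d)%:R + 3))) <= _).
    rewrite ler_wpM2r ?expR_ge0 // ler_pM ?natrX_expR //.
    rewrite natrX -[k%:R]mulr1 expRM_natl lerXn2r ?nnegrE ?expR_ge0 //.
    by apply: le_trans (expR_ge1Dx 1); rewrite -natr1.
  rewrite -!expRD ler_expR natrM -muln2 natrM; set D := (3 ^ d)%:R; lra.
(* The size of a support runs from [m] to [#|T|], whence the second factor [#|T|]. *)
pose ks := [seq k <- iota 1 #|T| | (m <= k)%N].
have [|mA PA] := @union_bound R _ _ P [seq bad k | k <- ks] (#|T|%:R * expR (- (2 * m%:R))).
  move=> A /mapP[k + ->]; rewrite mem_filter => /andP[mk _].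
  have [mb Pb] := badP k; split => //; apply: le_trans Pb _.
  by rewrite lee_fin ler_wpM2l // ler_expR lerN2 ler_wpM2l // ler_nat.
exists (\big[setU/set0]_(A <- [seq bad k | k <- ks]) A); split => //.
  apply: le_trans PA _; rewrite lee_fin ler_wpM2r ?mulr_ge0 ?expR_ge0 // ler_nat size_map.
  by rewrite size_filter -[X in (_ <= X)%N](size_iota 1) count_size.
move=> w nA x p xp U sp mU; rewrite ltnNge; apply/negP => UE; apply: nA.
set E := finset _ in UE.
rewrite -bigcup_seq; exists (bad #|U|) => /=.
  apply: map_f; rewrite mem_filter mU mem_iota (leq_trans m0 mU) add1n ltnS /=.
  exact: max_card.
rewrite /bad -bigcup_seq; exists (void E) => /=.
  apply: map_f; rewrite mem_filter UE /=; apply/flatten_mapP; exists U.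
    rewrite mem_filter eqxx /=; apply/flatten_mapP; exists x; first by rewrite mem_enum.
    by apply: map_f; rewrite -sp; exact: mem_walks.
  rewrite mem_enum inE; apply/fintype.subsetP => v; rewrite inE.
  by case/andP.
rewrite /void /count_event /= II0 card_eq0; apply/eqP/seteqP; split => // z [ez [v]].
by rewrite inE => /andP[_ /negP nv] vz; apply: nv; apply/asboolP; exists z.
Qed.

(** A walk of length [m.*2] meets boxes of total volume at most [3 * m * L ^ d]. The tail bound with
    [K * m] points then has exponent [(12 * L ^ d - K) * m], and [K] is large enough to absorb the
    number of walks too. *)
Lemma few_points_event (K m : nat) : (0 < m)%N ->
  12 * L ^+ d + 2 * (3 ^ d)%:R + 2 <= K%:R ->
  exists A : set Omega, [/\ measurable A,
    (P A <= (#|T|%:R * expR (- (2 * m%:R)))%:E)%E &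
    forall w, ~ A w -> forall (x : T) p, path (near 1) x p -> size p = m.*2 ->
      ~ atleast eta (boxes c L (finset (fun y => y \in x :: p))) (K * m) w].
Proof.
move=> m0 HK.
pose ps := flatten [seq [seq (x, p) | p <- walks m.*2 x] | x <- enum T].
pose ev (xp : T * seq T) :=
  atleast eta (boxes c L (finset (fun y => y \in xp.1 :: xp.2))) (K * m).
pose As := [seq ev xp | xp <- [seq xp <- ps | size xp.2 == m.*2]].
have sAs : (size As <= #|T| * (3 ^ d) ^ m.*2)%N.
  rewrite size_map size_filter; apply: leq_trans (count_size _ _) _; rewrite cardE.
  by apply: size_flatten_map_le => x _; rewrite size_map size_walks.
have [|mA PA] := @union_bound R _ _ P As (expR (- (K * m)%:R) * expR (12 * L ^+ d * m%:R)).
  move=> A /mapP[[x p] + ->]; rewrite mem_filter => /andP[/eqP /= sp _].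
  rewrite /ev /=; set U := finset _; have bU := borel_boxes c L U.
  split; first exact: (measurable_atleast peta).
  have vU := volume_boxes c L0 U.
  have v0 : 0 <= #|U|%:R * L ^+ d by rewrite mulr_ge0 // exprn_ge0 // ltW.
  apply: le_trans (poisson_tail peta _ bU vU v0) _; rewrite lee_fin ler_pM ?expR_ge0 //.
  - rewrite expRN lef_pV2 ?posrE ?exprn_gt0 ?expR_gt0 // -[X in expR X]mulr1 expRM_natl.
    rewrite lerXn2r ?nnegrE ?expR_ge0 //.
    (* The inequality [exp 1 <= 4] comes from squaring [1 / 2 <= exp (- 1 / 2)]. *)
    have h : 1 / 2 <= expR (- (1 / 2)) :> R by apply: le_trans (expR_ge1Dx _); lra.
    have : expR 1 * (expR (- (1 / 2)) * expR (- (1 / 2))) = 1 :> R.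
      by rewrite -!expRD -[RHS]expR0; congr expR; lra.
    have h2 : 1 / 4 <= expR (- (1 / 2)) * expR (- (1 / 2)) :> R by nra.
    by have := ler_wpM2l (expR_ge0 (1 : R)) h2; lra.
  - have U3 : (#|U| <= 3 * m)%N.
      rewrite cardsE; apply: leq_trans (card_size _) _; rewrite /= sp; lia.
    rewrite -(ler_nat R) natrM in U3.
    have := ler_wpM2r (exprn_ge0 d (ltW L0)) U3; rewrite ler_expR.
    by move: (#|U|%:R) (L ^+ d) (m%:R) => u l m'; lra.
exists (\big[setU/set0]_(A <- As) A); split => //.
  apply: le_trans PA _; rewrite lee_fin.
  apply: le_trans (_ : (#|T| * (3 ^ d) ^ m.*2)%:R * (expR (- (K * m)%:R) * expR (12 * L ^+ d * m%:R)) <= _).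
    by rewrite ler_wpM2r ?ler_nat // mulr_ge0 ?expR_ge0.
  rewrite natrM -mulrA ler_wpM2l //.
  apply: le_trans (_ : expR (m.*2 * 3 ^ d)%:R * (expR (- (K * m)%:R) * expR (12 * L ^+ d * m%:R)) <= _).
    by rewrite ler_wpM2r ?natrX_expR // mulr_ge0 ?expR_ge0.
  rewrite -!expRD ler_expR !natrM -muln2 natrM.
  have /(ler_wpM2r (ler0n _ m)) := HK; set D := (3 ^ d)%:R; lra.
move=> w nA x p xp sp xpA; apply: nA; rewrite -bigcup_seq.
exists (ev (x, p)) => //=; apply: map_f; rewrite mem_filter /= sp eqxx /=.
apply/flatten_mapP; exists x; first by rewrite mem_enum.
by apply: map_f; rewrite -sp; exact: mem_walks.
Qed.

End GoodEvents.

(** * Paths in grid boxes and choice of the constants *)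

Section BoxGeometry.
Variables (R : realType) (d n c : nat) (L : R).
Hypothesis L0 : 0 < L.
Local Notation T := {ffun 'I_d -> 'I_n}.

Lemma box_near (k : nat) (u v : T) (z z' : 'rV[R]_d) : box c L u z -> box c L v z' ->
  (forall i, `|z 0 i - z' 0 i| <= k%:R * L) -> near k u v.
Proof.
move=> uz vz zz; apply/nearP => i.
have aux (a b : nat) (s t : R) : s \in box_itv c L a -> t \in box_itv c L b ->
    s - t <= k%:R * L -> (a <= b + k)%N.
  rewrite !in_itv /= => /andP[s1 _] /andP[_ t2] st.
  rewrite -ltnS -(ltr_nat R) -(ltr_pM2r L0) -addSn natrD mulrDl; lra.
have := zz i; rewrite ler_norml => /andP[h1 h2]; split; apply: aux (uz i) (vz i) _ || apply: aux (vz i) (uz i) _; lra.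
Qed.

Lemma box_dist (k : nat) (u v : T) (z z' : 'rV[R]_d) i : box c L u z -> box c L v z' ->
  near k u v -> `|z 0 i - z' 0 i| <= k.+1%:R * L.
Proof.
move=> uz vz /nearP/(_ i)[uv vu].
have aux (a b : nat) (s t : R) : s \in box_itv c L a -> t \in box_itv c L b ->
    (a <= b + k)%N -> s - t <= k.+1%:R * L.
  rewrite !in_itv /= => /andP[_ s2] /andP[t1 _] ab.
  have : a.+1%:R * L <= (b%:R + k.+1%:R) * L by rewrite -natrD ler_pM2r // ler_nat addnS ltnS.
  lra.
have := aux _ _ _ _ (uz i) (vz i) uv; have := aux _ _ _ _ (vz i) (uz i) vu.
by rewrite ler_norml => h1 h2; apply/andP; split; lra.
Qed.

End BoxGeometry.

Section SymmetricGrid.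
Variables (R : realType) (d c : nat) (L : R).
Hypothesis L0 : 0 < L.
Local Notation T := {ffun 'I_d -> 'I_(2 * c)}.

Lemma box_exists (z : 'rV[R]_d) : (forall i, `|z 0 i| < c%:R * L) ->
  exists u : T, box c L u z.
Proof.
move=> zc; have H i : exists k : 'I_(2 * c), z 0 i \in box_itv c L k.
  have := zc i; rewrite ltr_norml => /andP[z1 z2].
  have s0 : 0 <= z 0 i / L + c%:R.
    by rewrite -lerBlDr sub0r ler_pdivlMr // mulNr ltW.
  have tl := s0; rewrite -truncn_le in tl; have tg := truncnS_gt (z 0 i / L + c%:R).
  move: tl tg; set k := Num.truncn _ => tl tg.
  have kc : (k < 2 * c)%N.
    rewrite -(ltr_nat R); apply: le_lt_trans tl _; rewrite mul2n -addnn natrD ltrD2r.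
    by rewrite ltr_pdivrMr.
  exists (Ordinal kc); rewrite in_itv /= -lerBlDr in tl *.
  by rewrite -ler_pdivlMr // -ltr_pdivrMr // tl ltrBrDr.
have [f fP] := boolp.choice H.
by exists (finfun f) => i; rewrite ffunE.
Qed.

Lemma box_cube (u : T) : box c L u `<=` cube (c%:R * L).
Proof.
move=> z uz i; have := uz i; rewrite in_itv /= => /andP[z1 z2].
have : (u i).+1%:R * L <= (2 * c%:R) * L by rewrite -(natrM _ 2) ler_pM2r // ler_nat.
have : 0 <= (u i)%:R * L by rewrite mulr_ge0 // ltW.
by move=> h1 h2; apply/andP; split; lra.
Qed.

End SymmetricGrid.

Section BoundedPath.
Variables (R : realType) (d : nat).
Local Notation V := 'rV[R]_d.+1.

(** The owner [a] of [z] is at least as close to [z] as [b] in Euclidean distance. Passing between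
    the sup and Euclidean norms costs a factor at most [d.+1], the dilation [D] used in
    [chain_cover]. *)
Lemma cell_close (xi : set V) (a b z : V) (rho : R) : xi a -> xi b -> voronoi_cell xi a z ->
  0 <= rho -> (forall i, `|b 0 i - z 0 i| <= rho) -> forall i, `|a 0 i - z 0 i| <= d.+1%:R * rho.
Proof.
move=> xa xb /(cellP _ xa)/(_ _ xb); rewrite -subr_le0 pw_sub subr_le0 => ab rho0 bz i.
have D1 : 1 <= d.+1%:R :> R by rewrite ler1n.
have D0 : 0 <= d.+1%:R * rho by rewrite mulr_ge0.
rewrite -(ler_sqr (x := `|_|)) ?nnegrE // real_normK ?num_real // exprMn.
apply: le_trans (_ : d.+1%:R * rho ^+ 2 <= _); last first.
  by rewrite ler_wpM2r ?sqr_ge0 // expr2 ler_peMr // (le_trans ler01).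
apply: le_trans (_ : dot (z - b) (z - b) <= _); last first.
  by apply: dot_sqr_le => j; rewrite !mxE distrC.
apply: le_trans ab; apply: le_trans (dot_sqr_ge _ i).
by rewrite !mxE -sqrrN opprB.
Qed.

(** Apply [chain_cover] to boxes sampled along the segment of [voronoi_path]. Occupied boxes of the
    grid hold points of [xi0] whatever [om] is, and [cell_close] puts each nucleus of the path in
    the dilated ball of a sample. By [gap] these nuclei stay inside the grid, hence inside
    [cube (2 * r)], where [om] has no point. *)
Lemma bounded_path (xi0 om : set V) (r : R) (c : nat) (L : R) (m K0 : nat) (x y : V) :
  let T := {ffun 'I_d.+1 -> 'I_(2 * c)} in
  let oc (v : T) := `[< exists z, xi0 z /\ box c L v z >] in
  let C := ((10 * d.+1 + 2) ^ d.+1)%N in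
  configuration xi0 -> configuration om -> om `<=` ~` cube (2 * r) ->
  1 <= L -> 0 <= r -> c%:R * L <= 2 * r -> 2 * r < c.+1%:R * L ->
  r + 1 + (d.+1 * (K0 + 5))%:R * L < c%:R * L ->
  (K0 < 2 * c)%N -> (2 * C * (c + 3) <= m)%N -> (m <= K0.+1 ^ d.+1)%N ->
  (forall (u : T) p, path (near 1) u p -> let U := finset (fun v => v \in u :: p) in
     size p = #|U|.-1.*2 -> (m <= #|U|)%N ->
     (2 * C * #|finset (fun v => (v \in U) && ~~ oc v)| < #|U|)%N) ->
  (xi0 `&` cube r) x -> (xi0 `&` cube r) y ->
  exists (u : T) p', [/\ path (near 1) u p', size p' = m.*2 &
    exists p, graph_path (induced_subgraph (voronoi_graph ((xi0 `&` cube (2 * r)) `|` om))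
        (cube (2 * r))) x y p /\
      forall z, z \in x :: p -> xi0 z /\ boxes c L (finset (fun v => v \in u :: p')) z].
Proof.
move=> T oc C cxi com om2 L1 r0 cL2 cL2' gap K02 mJ mK sparse [xx xr] [xy yr].
have L0 : 0 < L by lra.
set xi := (xi0 `&` cube (2 * r)) `|` om.
have cube12 : @cube R d.+1 r `<=` cube (2 * r).
  by move=> z zr i; have := zr i => /andP[h1 h2]; apply/andP; split; lra.
have cxi' : configuration xi.
  move=> s; rewrite /xi setIUl finite_setU; split; last exact: com.
  by apply: sub_finite_set (cxi s) => z [[]].
have xix : xi x by left; split => //; exact: cube12.
have xiy : xi y by left; split => //; exact: cube12.
have [q [qy [p [pp up lp pc]]]] := voronoi_path cxi' xix xiy ltr01.
have xr' i : `|x 0 i| <= r by rewrite ler_norml; exact: xr.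
have qr i : `|q 0 i| <= r + 1.
  have := qy i; rewrite ltr_norml ler_norml => /andP[q1 q2].
  by have /andP[y1 y2] := yr i; apply/andP; split; lra.
pose sg (t : R) : V := x + t *: (q - x).
have sgr t : 0 <= t <= 1 -> forall i, `|sg t 0 i| <= r + 1.
  move=> /andP[t0 t1] i; rewrite !mxE.
  have := xr' i; have := qr i; rewrite !ler_norml => /andP[q1 q2] /andP[x1 x2].
  by apply/andP; split; nra.
(* The segment has coordinate extent at most [2 * r + 1 < (c + 1) * L + 1 <= J * L], so consecutive
   samples are at most [L] apart. *)
pose J := (c + 2)%N.
have J0 : 0 < J%:R :> R by rewrite ltr0n /J addn2.
have sgd s t i : `|s - t| <= J%:R^-1 -> `|sg s 0 i - sg t 0 i| <= L.
  move=> st; have -> : sg s 0 i - sg t 0 i = (s - t) * (q 0 i - x 0 i) by rewrite !mxE; ring.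
  rewrite normrM; apply: le_trans (_ : J%:R^-1 * (2 * r + 1) <= _).
    rewrite ler_pM // (le_trans (ler_normB _ _)) //.
    by have := qr i; have := xr' i; lra.
  rewrite mulrC ler_pdivrMr // /J natrD; move: cL2'; rewrite -natr1; lra.
have [Q QP] : exists Q : nat -> T, forall j, (j <= J)%N -> box c L (Q j) (sg (j%:R / J%:R)).
  have H j : exists u : T, (j <= J)%N -> box c L u (sg (j%:R / J%:R)).
    have [jJ|_] := leqP j J; last first.
      have c0 : (0 < 2 * c)%N by lia.
      by exists [ffun=> Ordinal c0].
    have [|u uP] := @box_exists R d.+1 c L L0 (sg (j%:R / J%:R)); last by exists u.
    move=> i; apply: le_lt_trans (sgr _ _ i) _.
      by rewrite divr_ge0 //= ler_pdivrMr // mul1r ler_nat.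
    apply: le_lt_trans gap; rewrite lerDl mulr_ge0 //; lra.
  by have [Q QP] := boolp.choice H; exists Q.
have adjQ j : (j < J)%N -> near 1 (Q j) (Q j.+1).
  move=> jJ; apply: (box_near L0 (QP _ (ltnW jJ)) (QP _ jJ)) => i; rewrite mul1r.
  apply: sgd; rewrite -mulrBl -natr1 opprD addrA subrr sub0r mulN1r normrN.
  by rewrite ger0_norm // invr_ge0.
have mJ' : (2 * (10 * d.+1 + 2) ^ d.+1 * J.+1 <= m)%N by rewrite /J -addnS.
have [p' [pp' sp' HQ]] := @chain_cover d.+1 (2 * c) oc Q J d.+1 K0 m (ltn0Sn _) adjQ K02 mJ' mK sparse.
have key z : z \in x :: p -> (xi0 `&` cube (2 * r)) z /\
    boxes c L (finset (fun v => v \in Q 0%N :: p')) z.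
  move=> /pc[xiz [t [/andP[t0 t1] zt]]].
  have tJ0 : 0 <= t * J%:R by rewrite mulr_ge0.
  pose j := Num.truncn (t * J%:R).
  have jl : j%:R <= t * J%:R by rewrite truncn_le.
  have jg : t * J%:R < j.+1%:R := truncnS_gt _.
  have jJ : (j <= J)%N.
    by rewrite -(ler_nat R); apply: le_trans jl _; rewrite ler_piMl // ltW.
  have tj : `|t - j%:R / J%:R| <= J%:R^-1.
    have -> : t - j%:R / J%:R = (t * J%:R - j%:R) / J%:R by field; rewrite lt0r_neq0.
    rewrite normrM normfV (ger0_norm (ltW J0)) -[leRHS]mul1r ler_wpM2r ?invr_ge0 ?(ltW J0) //.
    by rewrite -natr1 in jg; rewrite ger0_norm; lra.
  have [k [v [kK /asboolP[b [xb vb]] vQ sub]]] := HQ j jJ.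
  rewrite inE in vQ.
  (* Boxes at grid distance [k.+1] have points at most [k.+2] sides apart; one more side leads from
     the sample to [sg t]. *)
  have bz i : `|b 0 i - sg t 0 i| <= k.+3%:R * L.
    have h1 := box_dist L0 i (QP j jJ) vb vQ.
    have h2 := sgd t (j%:R / J%:R) i tj.
    have := ler_distD (sg (j%:R / J%:R) 0 i) (b 0 i) (sg t 0 i).
    rewrite (distrC (b 0 i) (sg (_ / _) 0 i)) (distrC (sg (_ / _) 0 i) (sg t 0 i)).
    have e3 : k.+3%:R * L = k.+2%:R * L + L by rewrite -[k.+3]addn1 natrD mulrDl mul1r.
    by rewrite e3; lra.
  have xib : xi b.
    left; split => // i; have /andP[b1 b2] := box_cube L0 vb i.
    by apply/andP; split; lra.
  have kL0 : 0 <= k.+3%:R * L by rewrite mulr_ge0 // ltW.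
  have zz := cell_close xiz xib zt kL0 bz.
  have D1 : 1 <= d.+1%:R :> R by rewrite ler1n.
  (* The summand 5 in the dilation covers both the 3 of [k.+3] and the step from [sg t] back to the
     sample. *)
  have kK' : d.+1%:R * (k.+3%:R * L) + L <= (d.+1 * (k + 5))%:R * L.
    have DL : L <= d.+1%:R * L by rewrite ler_peMl // ltW.
    rewrite natrM natrD -[k.+3]addn3 natrD.
    by move: (d.+1%:R) (k%:R) DL => D kk; lra.
  have kK2 : (d.+1 * (k + 5))%:R * L <= (d.+1 * (K0 + 5))%:R * L.
    by rewrite ler_pM2r // ler_nat leq_mul2l leq_add2r ltnW // orbT.
  have [u uz] : exists u : T, box c L u z.
    apply: (box_exists L0) => i.
    have t01 : 0 <= t <= 1 by rewrite t0.
    have := ler_normD (z 0 i - sg t 0 i) (sg t 0 i); rewrite subrK.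
    move: (zz i) (sgr t t01 i) (le_trans kK' kK2) gap.
    by move: (d.+1%:R * (k.+3%:R * L)) ((d.+1 * (K0 + 5))%:R * L) => s1 s2; lra.
  have zU : boxes c L (finset (fun v => v \in Q 0%N :: p')) z.
    exists u => //; rewrite inE; apply: sub; rewrite inE.
    apply: (box_near L0 (QP j jJ) uz) => i.
    have h2 := sgd t (j%:R / J%:R) i tj; have h3 := zz i.
    have := ler_distD (sg t 0 i) (sg (j%:R / J%:R) 0 i) (z 0 i).
    rewrite (distrC (sg (_ / _) 0 i) (sg t 0 i)) (distrC (sg t 0 i) (z 0 i)).
    move: h2 h3 kK'; move: (d.+1%:R * (k.+3%:R * L)) ((d.+1 * (k + 5))%:R * L) => s1 s2; lra.
  split => //; case: xiz => // /om2; case => i.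
  by have /andP[b1 b2] := box_cube L0 uz i; apply/andP; split; lra.
exists (Q 0%N), p'; split => //; exists p; split; last first.
  by move=> z /key[[]].
split => //.
- by move=> z /key[[z1 z2] _]; split => //; left.
- apply: (sub_in_path (P := mem (x :: p))) pp; last by apply/allP.
  move=> u v /key[[_ u2] _] /key[[_ v2] _] /asboolP uv.
  by apply/asboolP.
Qed.

End BoundedPath.

Lemma uniq_size_le_card (T : choiceType) (A : set T) (k : nat) (s : seq T) :
  (A #= `I_k)%card -> uniq s -> (forall z, z \in s -> A z) -> (size s <= k)%N.
Proof.
move=> Ak us sA; rewrite -(card_fset_set Ak); apply: uniq_leq_size => // z /sA Az.
by rewrite in_fset_set ?inE //; apply/finite_setP; exists k.
Qed.

(** * Choice of the constants *)

Section Constants.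
Variables (R : realType) (d C D3 : nat).
Hypothesis C0 : (0 < C)%N.

(** [C] stands for the Vitali constant and [D3] for [3 ^ d]. The side [mesh] is the bound that
    [sparse_event] asks of [L ^ d], and [mass] is the one that [few_points_event] asks of [K]. *)
Definition mesh : nat := 2 * C * (2 * D3 + 3).
Definition mass : nat := 12 * mesh ^ d + 2 * D3 + 2.
(** Chosen so that [M <= cmin * r ^ d] leaves room for [m] boxes in a ball of radius
    [c %/ (20 * d)]. *)
Definition cmin : R := (mass%:R * (40 * d * mesh)%:R ^+ d)^-1.
(** Makes [M / mass] so large a multiple of [r] that [m] exceeds the chain term [2 * C * (c + 3)]
    and the entropy [d * r] of the grid. *)
Definition cmax : R := mass%:R * (8 * C + 2 * d + 8)%:R.

Lemma mesh_ge6 : (6 <= mesh)%N.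
Proof. by rewrite /mesh; nia. Qed.

Hypothesis d0 : (0 < d)%N.

Lemma mass_gt0 : (0 < mass)%N.
Proof. by rewrite /mass addn2. Qed.

Lemma cmin_gt0 : 0 < cmin.
Proof.
rewrite invr_gt0 mulr_gt0 ?ltr0n ?mass_gt0 // exprn_gt0 //.
by rewrite ltr0n muln_gt0 (leq_trans _ mesh_ge6) // muln_gt0 d0.
Qed.

Lemma cmax_gt0 : 0 < cmax.
Proof. by rewrite mulr_gt0 // ltr0n ?mass_gt0 // addn8. Qed.

Lemma scales (r M : R) : 1 <= r -> cmax * r <= M -> M <= cmin * r ^+ d ->
  exists c m : nat,
  [/\ [/\ c%:R * mesh%:R <= 2 * r, 2 * r < c.+1%:R * mesh%:R &
       r + 1 + (d * (c %/ (20 * d) + 5))%:R * mesh%:R < c%:R * mesh%:R],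
      [/\ (c %/ (20 * d) < 2 * c)%N, (2 * C * (c + 3) <= m)%N,
          (m <= (c %/ (20 * d)).+1 ^ d)%N & (0 < m)%N],
      (2 * c)%:R <= r, (mass * m)%:R <= M &
      1 + 2 * (d%:R * r) - 2 * m%:R <= - (cmin * M)].
Proof.
move=> r1 Mr rM.
have r0 : 0 < r by lra.
have K1 : 1 <= mass%:R :> R by rewrite ler1n mass_gt0.
have K0 : 0 < mass%:R :> R by lra.
have L6 : 6 <= mesh%:R :> R by rewrite (ler_nat R 6) mesh_ge6.
have L0 : 0 < mesh%:R :> R by lra.
have d1 : 1 <= d%:R :> R by rewrite ler1n.
have C1 : 1 <= C%:R :> R by rewrite ler1n.
have dL0 : 0 < (40 * d * mesh)%:R :> R.
  by rewrite ltr0n muln_gt0 (leq_trans _ mesh_ge6) // muln_gt0 d0.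
have MK : (8 * C%:R + 2 * d%:R + 8) * r <= M / mass%:R.
  have e : 8 * C%:R + 2 * d%:R + 8 = (8 * C + 2 * d + 8)%:R :> R by rewrite -!natrM -!natrD.
  by rewrite ler_pdivlMr // mulrC mulrA e.
have M0 : 0 <= M by apply: le_trans Mr; rewrite mulr_ge0 ?(ltW cmax_gt0) // ltW.
have MK0 : 0 <= M / mass%:R by rewrite divr_ge0 // ltW.
have [m [ml mg]] : exists m : nat, m%:R <= M / mass%:R /\ M / mass%:R < m%:R + 1.
  by exists (Num.truncn (M / mass%:R)); rewrite truncn_le natr1 truncnS_gt.
have rL0 : 0 <= 2 * r / mesh%:R by rewrite divr_ge0 // ?mulr_ge0 // ltW.
have [c [cl cg]] : exists c : nat, c%:R * mesh%:R <= 2 * r /\ 2 * r < c.+1%:R * mesh%:R.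
  exists (Num.truncn (2 * r / mesh%:R)).
  by rewrite -ler_pdivlMr // -ltr_pdivrMr // truncn_le truncnS_gt.
have [rho rhoE] : exists rho, rho = r / (40 * d * mesh)%:R by exists (r / (40 * d * mesh)%:R).
have rho0 : 0 <= rho by rewrite rhoE divr_ge0 // ltW.
have Mrho : M / mass%:R <= rho ^+ d.
  rewrite ler_pdivrMr //; apply: le_trans rM _.
  have -> : cmin * r ^+ d = mass%:R^-1 * rho ^+ d.
    by rewrite /cmin invfM rhoE expr_div_n -mulrA [_ * r ^+ d]mulrC.
  rewrite mulrC ler_wpM2l ?exprn_ge0 //.
  by rewrite (le_trans _ K1) // invf_le1.
have Cr0 : 0 <= C%:R * r by rewrite mulr_ge0 // ltW.
have dr0 : 0 <= d%:R * r by rewrite mulr_ge0 // ltW.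
have c0 : 0 <= c%:R :> R by [].
have cL6 : c%:R * 6 <= c%:R * mesh%:R :> R by rewrite ler_wpM2l.
have m1 : 1 <= m%:R :> R by lra.
(* The range of [M] is empty for small [r]: from [1 <= M / mass <= rho ^ d] follows
   [r >= 40 * d * mesh]. *)
have rho1 : 1 <= rho.
  rewrite leNgt; apply/negP => rho1.
  have : rho ^+ d < 1 by rewrite exprn_ilt1 // -lt0n.
  lra.
have c80 : (80 * d <= c)%N.
  rewrite -ltnS -(ltr_nat R) -(ltr_pM2r L0); apply: le_lt_trans cg.
  have : (40 * d * mesh)%:R <= r by rewrite -[leLHS]mul1r -ler_pdivlMr // -rhoE.
  by rewrite !natrM; lra.
exists c, m.
have := leq_trunc_div c (20 * d); have := leq_div c (20 * d).
have : (c < (c %/ (20 * d)).+1 * (20 * d))%N by rewrite -ltn_divLR // muln_gt0 d0.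
move: (c %/ (20 * d))%N => k ck kle kc; split.
- split => //.
  have h1 : (20 * (d * (k + 5)) <= c + 100 * d)%N.
    have e : forall a b : nat, (20 * (a * (b + 5)) = b * (20 * a) + 100 * a)%N by clear; lia.
    by rewrite e leq_add2r.
  have h2 : 20 * (d * (k + 5))%:R <= c%:R + 100 * d%:R :> R.
    by rewrite -!natrM -natrD ler_nat.
  have h3 : 80 * d%:R <= c%:R :> R by rewrite -natrM ler_nat.
  have h4 : 2 * r < (c%:R + 1) * mesh%:R by rewrite natr1.
  move: h2; move: ((d * (k + 5))%:R) => e h2.
  (* The cube of half-side [r] takes about half of the grid; this inequality makes the dilated
     radius fit in the rest. *)
  have h5 : 0 < (9 * c%:R - 20 * e - 30) by lra.
  by have := mulr_gt0 h5 L0; lra.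
- split.
  + by apply: leq_ltn_trans kle _; rewrite mul2n -addnn -addn1 leq_add2l (leq_trans _ c80) // muln_gt0 d0.
  + rewrite -(ler_nat R) !natrM natrD.
    have c4 : c%:R + 3 <= 4 * r by lra.
    have := ler_wpM2l (ler0n R C) c4; lra.
  + rewrite -(ler_nat R); apply: le_trans (le_trans ml Mrho) _; rewrite natrX.
    rewrite lerXn2r ?nnegrE // rhoE ler_pdivrMr //.
    have : c.+1%:R <= (k.+1 * (20 * d))%:R :> R by rewrite ler_nat.
    rewrite (natrM _ k.+1) (natrM _ 20) (natrM _ (40 * d)%N) (natrM _ 40) => ck'; 
    move: (ler_wpM2r (ltW L0) ck') cg; move: (c.+1%:R) (k.+1%:R) => cc kk; lra.
  + by rewrite -(ltr_nat R); lra.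
- by rewrite natrM; lra.
- by rewrite natrM mulrC -ler_pdivlMr.
- have : cmin * M <= M / mass%:R.
    rewrite mulrC ler_wpM2l // /cmin lef_pV2 ?posrE ?mulr_gt0 ?exprn_gt0 //.
    by rewrite ler_peMr ?(ltW K0) //; apply: exprn_ege1; rewrite ler1n -(ltr0n R).
  lra.
Qed.

End Constants.

Unset Implicit Arguments.

Theorem proposition2p3 (R : realType) (d : nat) (hd : (1 <= d)%N) :
  exists C0 c0 : R, 0 < C0 /\ 0 < c0 /\
    forall (disp : measure_display) (Omega : measurableType disp)
      (P : probability Omega R) (eta : Omega -> set 'rV[R]_d),
      poisson_process P eta ->
      forall r M : R, 1 <= r -> C0 * r <= M -> M <= c0 * r ^+ d ->
        prob_ge P (event_D eta r M) (1 - expR (- (c0 * M))).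
Proof.
case: d hd => // d _.
pose C := ((10 * d.+1 + 2) ^ d.+1)%N; pose D3 := (3 ^ d.+1)%N.
have C0 : (0 < C)%N by rewrite expn_gt0 addn2.
exists (cmax R d.+1 C D3), (cmin R d.+1 C D3).
split; first exact: cmax_gt0.
split; first exact: cmin_gt0.
move=> disp Omega P eta peta r M r1 Mr rM.
have [c [m [[cl cg gap] [k2 mJ mK m0] cr mM e0]]] := scales C0 (ltn0Sn d) r1 Mr rM.
set L : R := (mesh C D3)%:R in cl cg gap.
have L1 : 1 <= L by rewrite ler1n (leq_trans _ (mesh_ge6 D3 C0)).
have L0 : 0 < L by lra.
have HL : 2 * C%:R * (2 * (3 ^ d.+1)%:R + 3) <= L ^+ d.+1.
  apply: le_trans (_ : L <= _); last by rewrite ler_eXnr.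
  by rewrite /L /mesh -!(natrM, natrD).
have HK : 12 * L ^+ d.+1 + 2 * (3 ^ d.+1)%:R + 2 <= (mass d.+1 C D3)%:R.
  by rewrite /L /mass -natrX -!(natrM, natrD).
have [A1 [mA1 PA1 good1]] := sparse_event (2 * c) c L0 peta m0 C0 HL.
have [A2 [mA2 PA2 good2]] := few_points_event (2 * c) c L0 peta m0 HK.
(* The measurable event required inside [event_D] is the absence of both bad events. *)
exists (~` (A1 `|` A2)); split.
- by apply: measurableC; exact: measurableU.
- move=> w; rewrite setCU => -[w1 w2] om com om2 x y xx yy.
  have [u [p' [pp' sp' [p [gp pU]]]]] := bounded_path
    (poisson_configuration peta w) com om2 L1 (le_trans ler01 r1) cl cg gap k2 mJ mK
    (good1 w w1) xx yy.
  exists p; split => //.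
  have := good2 w w2 u p' pp' sp'; rewrite /atleast /= => /contrapT.
  rewrite -(big_mkord xpredT (fun k => count_event eta _ k)) -bigcup_seq.
  case=> k /=; rewrite mem_index_iota => /andP[_ km] wk.
  have [_ _ up _] := gp.
  have := uniq_size_le_card wk up pU; rewrite /= => pk.
  apply: le_trans mM; rewrite ler_nat; apply: ltnW; apply: leq_trans pk (ltnW km).
rewrite probability_setC; last exact: measurableU.
rewrite EFinB leeB //; apply: le_trans (measureU2 _ mA1 mA2) _.
apply: le_trans (leeD PA1 PA2) _; rewrite -EFinD lee_fin.
(* Together the bad events cost at most [2 * t ^ 2 * e], where the number of boxes satisfies
   [t <= r ^ d.+1 <= exp (d.+1 * r)]; the 2 is absorbed by [expR 1], as in the last inequality of
   [scales]. *)
set t := #|_|; have tE : t%:R = (2 * c)%:R ^+ d.+1 :> R by rewrite /t card_ffun !card_ord natrX.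
have c1 : 1 <= (2 * c)%:R :> R by rewrite ler1n; apply: leq_ltn_trans k2.
have t1 : 1 <= t%:R :> R by rewrite tE exprn_ege1.
have tr : t%:R <= expR (d.+1%:R * r).
  rewrite tE expRM_natl lerXn2r ?nnegrE ?expR_ge0 // (le_trans cr) //.
  by apply: le_trans (expR_ge1Dx r); rewrite lerDr.
set e := expR (- (2 * m%:R)).
have e_ge0 : 0 <= e by exact: expR_ge0.
have e2 : 2 <= expR 1 :> R by apply: le_trans (expR_ge1Dx 1).
apply: le_trans (_ : expR 1 * (expR (d.+1%:R * r) * expR (d.+1%:R * r) * e) <= _).
  have tt : t%:R <= t%:R * t%:R :> R by rewrite ler_peMl // (le_trans ler01).
  have tt2 : t%:R * t%:R <= expR (d.+1%:R * r) * expR (d.+1%:R * r) by rewrite ler_pM // (le_trans ler01).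
  have := ler_wpM2r e_ge0 tt; have := ler_wpM2r e_ge0 tt2.
  set q := expR (d.+1%:R * r) in tt2 *; set tR := t%:R => h1 h2.
  have h3 : 0 <= q * q * e by rewrite mulr_ge0 // mulr_ge0 // expR_ge0.
  have := ler_wpM2r h3 e2; lra.
rewrite /e -!expRD ler_expR; apply: le_trans e0; lra.
Qed.
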